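(* Let $c,d$ be positive integers with $c\ge d\ge2$. Let $A=k[x_1,\ldots,x_d]^{(c)}$ be the Veronese subring, where $k$ is a field of characteristic $p>0$, and let $\mathfrak m$ be the unique homogeneous maximal ideal of $A$. Then $$e_{HK}(R(\mathfrak m))=\frac{2^{d+1}\cdot c^{d-1}}{(d+1)!}-\frac{2c-d(d-1)}{c\,(d+1)!}\prod_{i=1}^{d-1}(c+i).$$
   Context: $k[x_1,\ldots,x_d]^{(c)}$ is the $k$-subalgebra of $k[x_1,\ldots,x_d]$ generated by all monomials of degree $c$; its homogeneous maximal ideal $\mathfrak m$ is generated by these monomials. $R(\mathfrak m)=\bigoplus_{n\ge0}\mathfrak m^nt^n=A[\mathfrak mt]$ is the Rees algebra, with homogeneous maximal ideal $\mathfrak M=(\mathfrak m,\mathfrak mt)$, and $e_{HK}(R(\mathfrak m)):=e_{HK}(R(\mathfrak m)_{\mathfrak M})$, where for a Noetherian local ring $(B,\mathfrak n)$ of characteristic $p>0$, $e_{HK}(B)=\lim_{e\to\infty}l_B(B/\mathfrak n^{[q]})/q^{\dim B}$ with $q=p^e$, $l$ denoting length and $\mathfrak n^{[q]}$ the ideal generated by the $q$-th powers of elements of $\mathfrak n$. *)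

(* Defs.v *)
From HB Require Import structures.
From mathcomp Require Import all_boot all_order all_algebra generic_quotient.
From mathcomp Require Import ring.
(* mpoly has to be imported before the files of MathComp-Analysis: in the
   opposite order the precedence levels of their notations clash. *)
From mathcomp Require Import mpoly.
From mathcomp Require Import all_classical all_reals ereal topology.
From mathcomp Require Import sequences normedtype.

Set Implicit Arguments.
Unset Strict Implicit.
Unset Printing Implicit Defensive.

Import Order.TTheory GRing.Theory Num.Theory.
Local Open Scope classical_set_scope.
Local Open Scope ring_scope.

Section Ideals.
Variable B : comNzRingType.
Implicit Types I J P X : set B.

(* Unlike [idealr_closed] of ring_quotient, the unit ideal is allowed. *)
Definition is_ideal I :=
  [/\ I 0, forall x y, I x -> I y -> I (x + y) & forall a x, I x -> I (a * x)].

Definition ideal_gen X : set B := smallest is_ideal X.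

Definition ideal_mul I J : set B :=
  ideal_gen [set z | exists x y, [/\ I x, J y & z = x * y]].

Fixpoint ideal_pow I n : set B :=
  if n is n'.+1 then ideal_mul I (ideal_pow I n') else setT.

(* I^[q] *)
Definition frob_power I (q : nat) : set B := ideal_gen [set x ^+ q | x in I].

Definition prime_ideal P :=
  [/\ is_ideal P, ~ P 1 & forall x y, P (x * y) -> P x \/ P y].

Definition maximal_ideal I :=
  [/\ is_ideal I, ~ I 1
    & forall J, is_ideal J -> ~ J 1 -> I `<=` J -> J = I].

Definition is_local I :=
  maximal_ideal I /\ forall J, maximal_ideal J -> J = I.

Variable R : realType.

Definition krull_dim : \bar R := ereal_sup
  [set n%:R%:E | n in [set n : nat | exists P : nat -> set B,
    (forall i, (i <= n)%N -> prime_ideal (P i)) /\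
    (forall i, (i < n)%N -> P i `<` P i.+1)]].

(* The length of the B-module B/I, for an ideal I; the submodules of B/I are
   the J/I, for J an ideal containing I. *)
Definition length_quot I : \bar R := ereal_sup
  [set n%:R%:E | n in [set n : nat | exists J : nat -> set B,
    [/\ I `<=` J 0%N,
        forall i, (i <= n)%N -> is_ideal (J i)
      & forall i, (i < n)%N -> J i `<` J i.+1]]].

(* [is_eHK p v] : B is local, of finite dimension D, and the limit defining
   its Hilbert-Kunz multiplicity in characteristic p exists and equals v. *)
Definition is_eHK (p : nat) (v : R) :=
  exists (n : set B) (D : nat),
    [/\ is_local n,
        krull_dim = D%:R%:E
      & (fun e : nat => (length_quot (frob_power n (p ^ e)) *
                         (((p ^ e)%:R ^+ D)^-1)%:E)%E) @ \oo --> v%:E].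

Lemma ideal_gen_ideal X : is_ideal (ideal_gen X).
Proof.
split.
- by move=> I [[]].
- by move=> x y hx hy I hI; case: (hI) => -[_ hD _] _; exact: hD (hx _ hI) (hy _ hI).
- by move=> a x hx I hI; case: (hI) => -[_ _ hM] _; exact: hM (hx _ hI).
Qed.

Lemma sub_ideal_gen X : X `<=` ideal_gen X.
Proof. by move=> x Xx I [_]; apply. Qed.

Lemma ideal_gen_min X I : is_ideal I -> X `<=` I -> ideal_gen X `<=` I.
Proof. by move=> hI hX x; apply. Qed.

Lemma ideal_pow_ideal I n : is_ideal (ideal_pow I n).
Proof. by case: n => [|n]; [split | apply: ideal_gen_ideal]. Qed.

Lemma is_idealN I x : is_ideal I -> I x -> I (- x).
Proof. by move=> [_ _ hM] hx; rewrite -mulN1r; apply: hM. Qed.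

Lemma ideal_powD I i j x y :
  ideal_pow I i x -> ideal_pow I j y -> ideal_pow I (i + j) (x * y).
Proof.
elim: i x => [|i IH] x hx hy.
  by have [_ _ hM] := ideal_pow_ideal I j; exact: hM.
have [h0 hD hM] := ideal_pow_ideal I (i.+1 + j).
pose K := [set x | ideal_pow I (i.+1 + j) (x * y)].
suff: K x by [].
move: x hx; apply: ideal_gen_min.
  rewrite /K; split => /=; first by rewrite mul0r.
    by move=> u v hu hv; rewrite mulrDl; apply: hD.
  by move=> a u hu; rewrite -mulrA; apply: hM.
move=> _ [u [v [hu hv ->]]]; rewrite /K /= -mulrA.
by apply: sub_ideal_gen; exists u, (v * y); split => //; apply: IH.
Qed.

End Ideals.

Section Localization.
Variables (A : comNzRingType) (P : set A) (hP : prime_ideal P).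

Record loc_frac := LocFrac { lnum : A; lden : A; _ : ~ P lden }.

HB.instance Definition _ := gen_eqMixin loc_frac.
HB.instance Definition _ := gen_choiceMixin loc_frac.

Lemma ldenP (x : loc_frac) : ~ P (lden x). Proof. by case: x. Qed.

Lemma not_prime1 : ~ P 1. Proof. by case: hP. Qed.

Lemma not_primeM x y : ~ P x -> ~ P y -> ~ P (x * y).
Proof. by move=> hx hy; case: hP => _ _ h /h []. Qed.

Definition loc_equiv (x y : loc_frac) : bool :=
  `[< exists2 u, ~ P u & u * (lnum x * lden y) = u * (lnum y * lden x) >].

Lemma loc_equiv_refl : reflexive loc_equiv.
Proof. by move=> x; apply/asboolP; exists 1 => //; exact: not_prime1. Qed.

Lemma loc_equiv_sym : ssrbool.symmetric loc_equiv.
Proof.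
by move=> x y; apply/asboolP/asboolP => -[u hu e]; exists u.
Qed.

Lemma loc_equiv_trans : transitive loc_equiv.
Proof.
move=> y x z /asboolP[u hu e] /asboolP[v hv f]; apply/asboolP.
exists (u * v * lden y); first by do 2?apply: not_primeM => //; apply: ldenP.
have -> : u * v * lden y * (lnum x * lden z) =
  u * (lnum x * lden y) * (v * lden z) by ring.
have -> : u * v * lden y * (lnum z * lden x) =
  v * (lnum z * lden y) * (u * lden x) by ring.
by rewrite e -f; ring.
Qed.

Canonical loc_equivRel :=
  EquivRel loc_equiv loc_equiv_refl loc_equiv_sym loc_equiv_trans.

Definition localization := {eq_quot loc_equiv}%qT.

HB.instance Definition _ : EqQuotient _ loc_equiv localization :=
  EqQuotient.on localization.
HB.instance Definition _ := Choice.on localization.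

(* The class of a/s *)
Definition loc_mk (a s : A) (hs : ~ P s) : localization :=
  \pi_localization%qT (LocFrac a hs).

Lemma loc_mkP a s (hs : ~ P s) b t (ht : ~ P t) :
  loc_mk a hs = loc_mk b ht <-> exists2 u, ~ P u & u * (a * t) = u * (b * s).
Proof.
split; first by move=> /eqmodP /asboolP.
by move=> h; apply/eqmodP/asboolP.
Qed.

Lemma loc_mk_ex (x : localization) : exists a s (hs : ~ P s), x = loc_mk a hs.
Proof.
elim/quotW: x => -[a s hs]; exists a, s, hs; reflexivity.
Qed.

Definition loc_addf (x y : loc_frac) :=
  LocFrac (lnum x * lden y + lnum y * lden x)
          (not_primeM (@ldenP x) (@ldenP y)).
Definition loc_mulf (x y : loc_frac) :=
  LocFrac (lnum x * lnum y) (not_primeM (@ldenP x) (@ldenP y)).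
Definition loc_oppf (x : loc_frac) := LocFrac (- lnum x) (@ldenP x).

Definition loc_add (x y : localization) : localization :=
  \pi_localization%qT (loc_addf (repr x) (repr y)).
Definition loc_mul (x y : localization) : localization :=
  \pi_localization%qT (loc_mulf (repr x) (repr y)).
Definition loc_opp (x : localization) : localization :=
  \pi_localization%qT (loc_oppf (repr x)).

Lemma repr_loc_mk a s (hs : ~ P s) :
  exists2 u, ~ P u & u * (lnum (repr (loc_mk a hs)) * s) =
                     u * (a * lden (repr (loc_mk a hs))).
Proof.
have /eqmodP /asboolP //= :
  \pi_localization%qT (repr (loc_mk a hs)) = \pi_localization%qT (LocFrac a hs).
by rewrite reprK.
Qed.

Lemma loc_addE a s (hs : ~ P s) b t (ht : ~ P t) :
  loc_add (loc_mk a hs) (loc_mk b ht) =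
  loc_mk (a * t + b * s) (not_primeM hs ht).
Proof.
have [u hu eu] := repr_loc_mk a hs; have [v hv ev] := repr_loc_mk b ht.
apply/eqmodP/asboolP => /=; exists (u * v); first exact: not_primeM.
move: eu ev; set x := repr _; set y := repr _ => eu ev.
have -> : u * v * ((lnum x * lden y + lnum y * lden x) * (s * t)) =
  u * (lnum x * s) * (v * lden y * t) + v * (lnum y * t) * (u * lden x * s)
  by ring.
by rewrite eu ev; ring.
Qed.

Lemma loc_mulE a s (hs : ~ P s) b t (ht : ~ P t) :
  loc_mul (loc_mk a hs) (loc_mk b ht) = loc_mk (a * b) (not_primeM hs ht).
Proof.
have [u hu eu] := repr_loc_mk a hs; have [v hv ev] := repr_loc_mk b ht.
apply/eqmodP/asboolP => /=; exists (u * v); first exact: not_primeM.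
move: eu ev; set x := repr _; set y := repr _ => eu ev.
have -> : u * v * (lnum x * lnum y * (s * t)) =
  u * (lnum x * s) * (v * (lnum y * t)) by ring.
by rewrite eu ev; ring.
Qed.

Lemma loc_oppE a s (hs : ~ P s) : loc_opp (loc_mk a hs) = loc_mk (- a) hs.
Proof.
have [u hu eu] := repr_loc_mk a hs.
apply/eqmodP/asboolP => /=; exists u => //.
by rewrite !mulNr !mulrN eu.
Qed.

Let loc0 := loc_mk 0 not_prime1.
Let loc1 := loc_mk 1 not_prime1.

Let loc_eq a s (hs : ~ P s) b t (ht : ~ P t) :
  a * t = b * s -> loc_mk a hs = loc_mk b ht.
Proof. by move=> e; apply/loc_mkP; exists 1; [exact: not_prime1|rewrite e]. Qed.

Let loc_addA : associative loc_add.
Proof.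
move=> x y z; have [a [s [hs ->]]] := loc_mk_ex x.
have [b [t [ht ->]]] := loc_mk_ex y; have [c [r [hr ->]]] := loc_mk_ex z.
by rewrite !loc_addE; apply: loc_eq; ring.
Qed.

Let loc_addC : commutative loc_add.
Proof.
move=> x y; have [a [s [hs ->]]] := loc_mk_ex x.
have [b [t [ht ->]]] := loc_mk_ex y.
by rewrite !loc_addE; apply: loc_eq; ring.
Qed.

Let loc_add0 : left_id loc0 loc_add.
Proof.
move=> x; have [a [s [hs ->]]] := loc_mk_ex x.
by rewrite loc_addE; apply: loc_eq; ring.
Qed.

Let loc_addN : left_inverse loc0 loc_opp loc_add.
Proof.
move=> x; have [a [s [hs ->]]] := loc_mk_ex x.
by rewrite loc_oppE loc_addE; apply: loc_eq; ring.
Qed.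

HB.instance Definition _ :=
  GRing.isZmodule.Build localization loc_addA loc_addC loc_add0 loc_addN.

Let loc_mulA : associative loc_mul.
Proof.
move=> x y z; have [a [s [hs ->]]] := loc_mk_ex x.
have [b [t [ht ->]]] := loc_mk_ex y; have [c [r [hr ->]]] := loc_mk_ex z.
by rewrite !loc_mulE; apply: loc_eq; ring.
Qed.

Let loc_mulC : commutative loc_mul.
Proof.
move=> x y; have [a [s [hs ->]]] := loc_mk_ex x.
have [b [t [ht ->]]] := loc_mk_ex y.
by rewrite !loc_mulE; apply: loc_eq; ring.
Qed.

Let loc_mul1 : left_id loc1 loc_mul.
Proof.
move=> x; have [a [s [hs ->]]] := loc_mk_ex x.
by rewrite loc_mulE; apply: loc_eq; ring.
Qed.

Let loc_mulDl : left_distributive loc_mul loc_add.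
Proof.
move=> x y z; have [a [s [hs ->]]] := loc_mk_ex x.
have [b [t [ht ->]]] := loc_mk_ex y; have [c [r [hr ->]]] := loc_mk_ex z.
by rewrite !(loc_mulE, loc_addE); apply: loc_eq; ring.
Qed.

Let loc1_neq0 : loc1 != loc0.
Proof.
apply/eqP => /loc_mkP [u hu]; rewrite mul0r !mulr1 mulr0 => u0.
by case: hu; rewrite u0; case: hP => -[].
Qed.

HB.instance Definition _ := GRing.Zmodule_isComNzRing.Build localization
  loc_mulA loc_mulC loc_mul1 loc_mulDl loc1_neq0.

End Localization.

Section Rees.
Variables (A : comNzRingType) (I : set A).

(* The Rees algebra: the polynomials in t whose coefficient of t^n lies in
   I^n. *)
Definition rees_pred : {pred {poly A}} :=
  [pred f : {poly A} | `[< forall n, ideal_pow I n f`_n >]].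

Record rees := Rees { rees_val : {poly A}; _ : rees_val \in rees_pred }.

Lemma rees_subring : subring_closed rees_pred.
Proof.
split.
- apply/asboolP => n; rewrite coef1; case: n => [//|n] /=.
  by case: (ideal_pow_ideal I n.+1).
- move=> f g /asboolP hf /asboolP hg; apply/asboolP => n; rewrite coefB.
  have hI := ideal_pow_ideal I n; case: (hI) => _ hD _.
  by apply: hD => //; apply: is_idealN.
- move=> f g /asboolP hf /asboolP hg; apply/asboolP => n; rewrite coefM.
  have [h0 hD _] := ideal_pow_ideal I n.
  apply: big_ind => // -[i /= hi] _.
  by rewrite -[in ideal_pow _ n](subnKC (hi : i <= n)%N); apply: ideal_powD.
Qed.

HB.instance Definition _ := [isSub for rees_val].
HB.instance Definition _ := [Choice of rees by <:].
HB.instance Definition _ :=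
  GRing.isSubringClosed.Build {poly A} rees_pred rees_subring.
HB.instance Definition _ := [SubChoice_isSubComNzRing of rees by <:].

(* The ideal of the Rees algebra A[It] generated by I and It. *)
Definition rees_max : set rees := ideal_gen
  [set f | exists2 a, I a & val f = a%:P \/ val f = a *: 'X].

Lemma rees_monomial n a :
  ideal_pow I n a -> (a *: 'X^n : {poly A}) \in rees_pred.
Proof.
move=> ha; apply/asboolP => i; rewrite coefZ coefXn.
case: eqP => [->|_]; first by rewrite mulr1.
by rewrite mulr0; case: (ideal_pow_ideal I i).
Qed.

Lemma rees_maxP : is_ideal I ->
  forall f, rees_max f <-> I (rees_val f)`_0.
Proof.
move=> hI; have [h0 hD hM] := hI; have [m0 mD mM] := ideal_gen_ideal
  [set f : rees | exists2 a, I a & val f = a%:P \/ val f = a *: 'X].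
move=> f; split.
  move: f; apply: ideal_gen_min.
    split => /=; first by rewrite coef0.
      by move=> x y hx hy; rewrite coefD; apply: hD.
    by move=> x y hy; rewrite coefM big_ord1; apply: hM.
  move=> g [a ha] /= [] ->; first by rewrite coefC.
  by rewrite coefZ coefX mulr0.
move=> f0.
pose K (h : {poly A}) := exists2 g : rees, rees_max g & val g = h.
suff [g hg /val_inj <-] : K (val f) by [].
have K0 : K 0 by exists 0.
have KD : forall x y, K x -> K y -> K (x + y).
  by move=> _ _ [x hx <-] [y hy <-]; exists (x + y) => //; apply: mD.
have /asboolP fP : rees_val f \in rees_pred by case: f {f0}.
rewrite -[val f]coefK poly_def; apply: big_ind => // -[i /= _] _.
case: i => [|n].
  have hg : ((rees_val f)`_0 *: 'X^0 : {poly A}) \in rees_pred.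
    exact: rees_monomial.
  exists (Rees hg) => //; apply: sub_ideal_gen.
  by exists (rees_val f)`_0 => //; left; rewrite /= expr0 alg_polyC.
suff : [set a : A | K (a *: 'X^(n.+1))] (rees_val f)`_n.+1 by [].
move: (fP n.+1); apply: ideal_gen_min.
  split => /=; first by rewrite scale0r.
    by move=> x y hx hy; rewrite scalerDl; apply: KD.
  move=> b x [g hg eg].
  have hb : (b *: 'X^0 : {poly A}) \in rees_pred by exact: rees_monomial.
  exists (Rees hb * g); first exact: mM.
  by rewrite /= in eg *; rewrite eg expr0 -scalerAl mul1r scalerA.
move=> _ [x [y [hx hy ->]]] /=.
have hxt : (x *: 'X^1 : {poly A}) \in rees_pred.
  apply: rees_monomial; rewrite -[x]mulr1.
  by apply: sub_ideal_gen; exists x, 1.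
exists (Rees (rees_monomial hy) * Rees hxt).
  by apply: mM; apply: sub_ideal_gen; exists x => //; right; rewrite /= expr1.
by rewrite /= -scalerAl -scalerAr scalerA -exprD addn1 mulrC.
Qed.

Lemma rees_max_prime : prime_ideal I -> prime_ideal rees_max.
Proof.
move=> [hI h1 hP]; split; first exact: ideal_gen_ideal.
  by move/(rees_maxP hI); rewrite /= coef1.
move=> f g /(rees_maxP hI); rewrite /= coefM big_ord1 => /hP[] h.
  by left; apply/(rees_maxP hI).
by right; apply/(rees_maxP hI).
Qed.

End Rees.

Section Veronese.
Variables (k : fieldType) (d c : nat).

Definition monomials_of_deg : set {mpoly k[d]} :=
  [set f | exists2 m : 'X_{1..d}, mdeg m = c & f = 'X_[m]].

(* k[x_1, ..., x_d]^(c), the k-subalgebra generated by monomials_of_deg *)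
Definition veronese_pred : {pred {mpoly k[d]}} :=
  mem (smallest (fun B : set {mpoly k[d]} => subalg_closed (mem B))
                monomials_of_deg).

Record veronese :=
  Veronese { veronese_val : {mpoly k[d]}; _ : veronese_val \in veronese_pred }.

Lemma veronese_subalg : subalg_closed veronese_pred.
Proof.
split.
- by rewrite inE => B [[h _ _] _]; rewrite inE in h.
- move=> a f g /set_mem hf /set_mem hg; apply/mem_set => B hB.
  case: (hB) => -[_ h _] _; apply/set_mem.
  by apply: h; apply/mem_set; [apply: hf | apply: hg].
- move=> f g /set_mem hf /set_mem hg; apply/mem_set => B hB.
  case: (hB) => -[_ _ h] _; apply/set_mem.
  by apply: h; apply/mem_set; [apply: hf | apply: hg].
Qed.

HB.instance Definition _ := [isSub for veronese_val].
HB.instance Definition _ := [Choice of veronese by <:].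
HB.instance Definition _ :=
  GRing.isSubalgClosed.Build k {mpoly k[d]} veronese_pred veronese_subalg.
HB.instance Definition _ := [SubChoice_isSubComNzRing of veronese by <:].
HB.instance Definition _ := [SubZmodule_isSubLmodule of veronese by <:].
HB.instance Definition _ :=
  [SubNzRing_SubLmodule_isSubLalgebra of veronese by <:].
HB.instance Definition _ := [SubLalgebra_isSubAlgebra of veronese by <:].

Definition veronese_max : set veronese :=
  ideal_gen [set f | monomials_of_deg (val f)].

Hypothesis c_gt0 : (0 < c)%N.

Lemma veronese_maxP f : veronese_max f <-> (veronese_val f)@_0%MM = 0.
Proof.
have [m0 mD mM] := ideal_gen_ideal
  [set f : veronese | monomials_of_deg (val f)].
have cX (m : 'X_{1..d}) : mdeg m = c -> ('X_[m] : {mpoly k[d]})@_0%MM = 0.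
  move=> hm; rewrite mcoeffX; case: eqP => // m_eq0.
  by move: c_gt0; rewrite -hm m_eq0 mdeg0.
split.
  move: f; apply: ideal_gen_min.
    split => /=; first by rewrite mcoeff0.
      by move=> x y hx hy; rewrite mcoeffD hx hy addr0.
    by move=> x y hy; rewrite rmorphM /= hy mulr0.
  by move=> g [m hm /= ->]; apply: cX.
move=> f0.
have mZ (a : k) x : veronese_max x -> veronese_max (a *: x).
  move=> hx; have -> : a *: x = (a *: 1) * x.
    by apply: val_inj; rewrite /= -scalerAl mul1r.
  exact: mM.
pose K (h : {mpoly k[d]}) := exists g m : veronese,
  [/\ val g = h, veronese_max m & val m = h - h@_0%MM *: 1].
have [] : K (val f); last first.
  move=> g [m [_ hm]]; rewrite /= f0 scale0r subr0.
  by move=> /val_inj <-.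
have /set_mem Pf : val f \in veronese_pred by case: f {f0}.
apply: (Pf [set h | K h]); split; last first.
  move=> _ [m hm ->].
  have hv : 'X_[m] \in veronese_pred.
    by apply/mem_set => B [_]; apply; exists m.
  exists (Veronese hv), (Veronese hv); split => //.
    by apply: sub_ideal_gen; exists m.
  by rewrite cX // scale0r subr0.
split.
- rewrite inE; exists 1, 0; split => //=.
  by rewrite mcoeff1 eqxx scale1r subrr.
- move=> a x y; rewrite !inE => -[g [m [<- hm em]]] [g' [m' [<- hm' em']]].
  exists (a *: g + g'), (a *: m + m'); split => //.
    by apply: mD => //; apply: mZ.
  rewrite /= in em em' *; rewrite em em' mcoeffD mcoeffZ.
  by rewrite scalerBr scalerDl scalerA opprD addrACA.
- move=> x y; rewrite !inE => -[g [m [<- hm em]]] [g' [m' [<- hm' em']]].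
  exists (g * g'), (g' * m + (val g)@_0%MM *: m'); split => //.
    by apply: mD; [apply: mM | apply: mZ].
  rewrite /= in em em' *; rewrite em em' rmorphM /= mulrBr scalerBr scalerA.
  by rewrite -scalerAr mulr1 addrA subrK mulrC.
Qed.

Lemma veronese_max_prime : prime_ideal veronese_max.
Proof.
split; first exact: ideal_gen_ideal.
  by move/veronese_maxP/eqP; rewrite /= mcoeff1 eqxx oner_eq0.
move=> f g /veronese_maxP; rewrite /= rmorphM /= => /eqP.
by rewrite mulf_eq0 => /orP[] /eqP h; [left|right]; apply/veronese_maxP.
Qed.

End Veronese.

(* R(m)_M, for m the homogeneous maximal ideal of the Veronese subring *)
Definition veronese_rees_loc (k : fieldType) (d c : nat) (hc : (0 < c)%N) :
    comNzRingType :=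
  localization (rees_max_prime (veronese_max_prime k d hc)).

(* Main.v *)
(** The Rees algebra is the monoid algebra of the exponents (b, n) with c | |b|
    and c n <= |b|. In characteristic p the ideal M^[q] is spanned by the
    monomials x^b t^n with sum_i floor(b_i / q) >= c such that c (n + q) <= |b|
    or q <= n, and a filtration by monomials, taken in the order of their
    degrees, shows that the length of the localization modulo the q-th powers
    is the number of the remaining exponents. For a given b with |b| = c j, the
    number of admissible n is j + 1 if sum_i floor(b_i / q) < c, and 2q - 1 - j
    otherwise. Counting 2q - 1 - j for all b with j < 2q gives the term
    2^(d+1) c^(d-1) / (d+1)!; the correction 2j + 2 - 2q is summed over the boxes
    q l + [0, q)^d with |l| < c, in each of which the condition c | |b| selects
    asymptotically one point out of c. *)

Require Import Defs.
From mathcomp Require Import all_boot all_order all_algebra reals.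
From mathcomp Require Import ring lra zify.
From mathcomp Require Import mpoly.
From mathcomp Require Import all_classical ereal topology sequences normedtype.
Import Order.TTheory GRing.Theory Num.Theory numFieldNormedType.Exports.

Set Implicit Arguments.
Unset Strict Implicit.
Unset Printing Implicit Defensive.

Local Open Scope classical_set_scope.
Local Open Scope ring_scope.

(** * Ideals of a localization *)

(** Dimension and length are suprema over chains, so each is found by exhibiting one chain and
    bounding all others. Contraction moves chains of the localization into the Rees algebra, and an
    ideal saturated for the complement of M is recovered from its extension. Both upper bounds are
    linear algebra over k: too long a chain, of primes or of ideals above M^[q], provides more
    elements than there are coefficients to kill.

    The condition d <= c keeps the boxes with |l| < c below degree 2 c q. There j < 2 q, so that j +
    1 is exactly 2 q - 1 - j plus the correction, without truncation.

    Inside a box the condition c | |b| is removed by averaging over c consecutive translates of the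
    summand; a translation changes the sum by one order of q less than its size. The leading
    coefficients 2 |l| - 2 c + d of the boxes have mean (d (d - 1) - 2 c) / (d + 1), the origin of
    the factor 2 c - d (d - 1). *)

Section LocalizationIdeals.
Variables (A : comNzRingType) (P : set A) (hP : prime_ideal P).
Local Notation B := (localization hP).
Implicit Types (K Q : set A) (J : set B).

Lemma loc_mkD a s (hs : ~ P s) b t (ht : ~ P t) :
  loc_mk hP a hs + loc_mk hP b ht =
  loc_mk hP (a * t + b * s) (not_primeM hP hs ht).
Proof. exact: loc_addE. Qed.

Lemma loc_mkM a s (hs : ~ P s) b t (ht : ~ P t) :
  loc_mk hP a hs * loc_mk hP b ht = loc_mk hP (a * b) (not_primeM hP hs ht).
Proof. exact: loc_mulE. Qed.

Lemma loc_mk_eq a s (hs : ~ P s) b t (ht : ~ P t) :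
  a * t = b * s -> loc_mk hP a hs = loc_mk hP b ht.
Proof.
by move=> e; apply/loc_mkP; exists 1; [exact: not_prime1 | rewrite e].
Qed.

Definition loc_in (a : A) : B := loc_mk hP a (not_prime1 hP).

Lemma loc_in0 : loc_in 0 = 0. Proof. by []. Qed.
Lemma loc_in1 : loc_in 1 = 1. Proof. by []. Qed.

Lemma loc_inD a b : loc_in (a + b) = loc_in a + loc_in b.
Proof. by rewrite loc_mkD; apply: loc_mk_eq; ring. Qed.

Lemma loc_inM a b : loc_in (a * b) = loc_in a * loc_in b.
Proof. by rewrite loc_mkM; apply: loc_mk_eq; ring. Qed.

Lemma loc_inX a n : loc_in (a ^+ n) = loc_in a ^+ n.
Proof. by elim: n => [|n IH]; rewrite ?expr0 // !exprS loc_inM IH. Qed.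

Lemma loc_mk_scale a s (hs : ~ P s) :
  loc_mk hP a hs = loc_mk hP 1 hs * loc_in a.
Proof. by rewrite loc_mkM; apply: loc_mk_eq; ring. Qed.

Lemma loc_in_scale a s (hs : ~ P s) : loc_in a = loc_in s * loc_mk hP a hs.
Proof. by rewrite loc_mkM; apply: loc_mk_eq; ring. Qed.

Definition contract J : set A := [set a | J (loc_in a)].

Definition extend K : set B :=
  [set x | exists a s (hs : ~ P s), K a /\ x = loc_mk hP a hs].

Definition saturated K := forall s a, ~ P s -> K (s * a) -> K a.

Lemma contract_ideal J : is_ideal J -> is_ideal (contract J).
Proof.
move=> [h0 hD hM]; split; rewrite /contract /=.
- by rewrite loc_in0.
- by move=> x y hx hy; rewrite loc_inD; apply: hD.
- by move=> a x hx; rewrite loc_inM; apply: hM.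
Qed.

Lemma mem_contract J a s (hs : ~ P s) : is_ideal J ->
  J (loc_mk hP a hs) <-> contract J a.
Proof.
move=> [_ _ hM]; split; rewrite /contract /= => h.
  by rewrite (loc_in_scale _ hs); apply: hM.
by rewrite loc_mk_scale; apply: hM.
Qed.

Lemma contract_proper J J' : is_ideal J -> is_ideal J' ->
  J `<` J' -> contract J `<` contract J'.
Proof.
move=> hJ hJ' [JJ' nJ]; split; first by move=> a; apply: JJ'.
move=> h; apply: nJ => x; have [a [s [hs ->]]] := loc_mk_ex x.
by rewrite !mem_contract //; apply: h.
Qed.

Lemma contract_prime J : prime_ideal J -> prime_ideal (contract J).
Proof.
move=> [hJ h1 hM]; split; first exact: contract_ideal.
  by rewrite /contract /= loc_in1.
by move=> x y; rewrite /contract /= loc_inM => /hM.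
Qed.

Lemma extend_ideal K : is_ideal K -> is_ideal (extend K).
Proof.
move=> [h0 hD hM]; split.
- by exists 0, 1, (not_prime1 hP).
- move=> _ _ [a [s [hs [Ka ->]]]] [b [t [ht [Kb ->]]]].
  exists (a * t + b * s), (s * t), (not_primeM hP hs ht); rewrite loc_mkD.
  by split => //; apply: hD; rewrite mulrC; apply: hM.
- move=> x _ [b [t [ht [Kb ->]]]]; have [a [s [hs ->]]] := loc_mk_ex x.
  exists (a * b), (s * t), (not_primeM hP hs ht); rewrite loc_mkM.
  by split => //; apply: hM.
Qed.

(** An equality of fractions leaves two factors outside [P], the denominator and the multiplier [u];
    saturation cancels both. *)
Lemma contract_extend K : is_ideal K -> saturated K -> contract (extend K) = K.
Proof.
move=> [_ _ hM] satK; apply/seteqP; split=> a; last first.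
  by move=> Ka; exists a, 1, (not_prime1 hP).
move=> [b [s [hs [Kb /loc_mkP [u hu]]]]]; rewrite mulr1 => e.
apply: (satK s) => //; apply: (satK u) => //.
have -> : u * (s * a) = u * b by rewrite -e; ring.
exact: hM.
Qed.

Lemma extend_proper K K' : is_ideal K -> is_ideal K' ->
  saturated K -> saturated K' -> K `<` K' -> extend K `<` extend K'.
Proof.
move=> hK hK' sK sK' [KK' nK]; split.
  by move=> _ [a [s [hs [Ka ->]]]]; exists a, s, hs; split => //; apply: KK'.
move=> h; apply: nK => a; rewrite -(contract_extend hK' sK') => /h.
by rewrite -[in X in _ -> X](contract_extend hK sK).
Qed.

Lemma prime_saturated Q : prime_ideal Q -> Q `<=` P -> saturated Q.
Proof. by move=> [_ _ hQ] QP s a nPs /hQ[/QP//|]. Qed.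

Lemma extend_prime Q : prime_ideal Q -> Q `<=` P -> prime_ideal (extend Q).
Proof.
move=> pQ QP; have sQ := prime_saturated pQ QP; have [iQ Q1 hQ] := pQ.
have ctr a s (hs : ~ P s) : extend Q (loc_mk hP a hs) <-> Q a.
  by rewrite mem_contract ?contract_extend //; apply: extend_ideal.
split; first exact: extend_ideal.
  by rewrite -loc_in1 => /ctr.
move=> x y; have [a [s [hs ->]]] := loc_mk_ex x.
have [b [t [ht ->]]] := loc_mk_ex y.
by rewrite loc_mkM !ctr; apply: hQ.
Qed.

Lemma proper_ideal_loc J : is_ideal J -> ~ J 1 -> J `<=` extend P.
Proof.
move=> hJ J1 x; have [a [s [hs ->]]] := loc_mk_ex x => Jx.
exists a, s, hs; split => //; apply: contrapT => nPa; apply: J1.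
have [_ _ hM] := hJ.
suff -> : 1 = loc_mk hP s nPa * loc_mk hP a hs by apply: hM.
by rewrite loc_mkM -loc_in1; apply: loc_mk_eq; ring.
Qed.

Lemma loc_is_local : is_local (extend P).
Proof.
have [iP P1 _] := extend_prime hP (@subset_refl _ P).
split.
  split=> // J hJ J1 PJ; apply/seteqP; split => //.
  exact: proper_ideal_loc.
move=> J [hJ J1 maxJ]; apply/esym/maxJ => //; exact: proper_ideal_loc.
Qed.

Lemma proper_chain_sub (T : Type) (J : nat -> set T) n :
  (forall i, (i < n)%N -> J i `<` J i.+1) ->
  forall i j, (i <= j <= n)%N -> J i `<=` J j.
Proof.
move=> ch i j /andP[]; elim: j => [|j IH]; first by rewrite leqn0 => /eqP -> _;
  exact: subset_refl.
rewrite leq_eqVlt => /orP[/eqP -> _|le_ij lt_jn]; first exact: subset_refl.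
by apply: subset_trans (IH le_ij (ltnW lt_jn)) _; case: (ch _ lt_jn).
Qed.

Section KrullDim.
Variable (R : realType) (D : nat).

Hypothesis chainP : exists Q : nat -> set A,
  [/\ forall i, (i <= D)%N -> prime_ideal (Q i),
      forall i, (i < D)%N -> Q i `<` Q i.+1 & Q D `<=` P].
Hypothesis no_chain : forall n (Q : nat -> set A),
  (forall i, (i <= n)%N -> prime_ideal (Q i)) ->
  (forall i, (i < n)%N -> Q i `<` Q i.+1) -> (n <= D)%N.

(** Contraction keeps the inclusions between primes strict, and so does extension of primes
    contained in [P]. *)
Lemma krull_dim_loc : @krull_dim B R = D%:R%:E.
Proof.
apply/eqP; rewrite eq_le; apply/andP; split.
  apply: ge_ereal_sup => _ [n [J [pJ chJ]] <-].
  rewrite lee_fin ler_nat; apply: (@no_chain n (fun i => contract (J i))).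
    by move=> i hi; apply/contract_prime/pJ.
  move=> i hi; apply: contract_proper; last exact: chJ.
    by case: (pJ i (ltnW hi)).
  by case: (pJ i.+1 hi).
have [Q [pQ chQ QP]] := chainP.
have {}QP i : (i <= D)%N -> Q i `<=` P.
  move=> hi; apply: subset_trans QP.
  by apply: (proper_chain_sub chQ); rewrite hi leqnn.
apply: ereal_sup_ubound; exists D => //; exists (fun i => extend (Q i)).
split=> i hi; first by apply: extend_prime; [exact: pQ | exact: QP].
have [iQ _ _] := pQ i (ltnW hi); have [iQ' _ _] := pQ i.+1 hi.
apply: extend_proper => //; last exact: chQ.
  by apply: prime_saturated; [apply: pQ; apply: ltnW | apply: QP; apply: ltnW].
by apply: prime_saturated; [apply: pQ | apply: QP].
Qed.

End KrullDim.

Section Length.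
Variable (R : realType) (q L : nat).

Hypothesis chainK : exists K : nat -> set A,
  [/\ forall x, P x -> K 0%N (x ^+ q),
      forall i, (i <= L)%N -> is_ideal (K i) /\ saturated (K i)
    & forall i, (i < L)%N -> K i `<` K i.+1].
Hypothesis no_chain : forall n (K : nat -> set A),
  frob_power P q `<=` K 0%N ->
  (forall i, (i <= n)%N -> is_ideal (K i)) ->
  (forall i, (i < n)%N -> K i `<` K i.+1) -> (n <= L)%N.

(** Contracted chains lie above [frob_power P q], which bounds the supremum; the extension of the
    saturated chain in [chainK] keeps its [L] strict steps and attains it. *)
Lemma length_quot_loc :
  @length_quot B R (frob_power (extend P) q) = L%:R%:E.
Proof.
apply/eqP; rewrite eq_le; apply/andP; split.
  apply: ge_ereal_sup => _ [n [J [IJ iJ chJ]] <-].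
  rewrite lee_fin ler_nat; apply: (@no_chain n (fun i => contract (J i))).
  - apply: ideal_gen_min; first by apply: contract_ideal; apply: iJ.
    move=> _ [x Px <-]; apply: IJ; apply: sub_ideal_gen.
    exists (loc_in x); last by rewrite loc_inX.
    by exists x, 1, (not_prime1 hP).
  - by move=> i hi; apply/contract_ideal/iJ.
  - by move=> i hi; apply: contract_proper (chJ i hi); apply: iJ => //; apply: ltnW.
have [K [K0 iK chK]] := chainK.
apply: ereal_sup_ubound; exists L => //; exists (fun i => extend (K i)); split.
- apply: ideal_gen_min; first by apply: extend_ideal; case: (iK 0%N (leq0n _)).
  move=> _ [_ [a [s [hs [Pa ->]]]] <-].
  (* The denominator of the power carries its own proof of lying outside [P], hence the
     existential. *)
  have mkX n : exists hsn : ~ P (s ^+ n), loc_mk hP a hs ^+ n = loc_mk hP (a ^+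
    n) hsn.
    elim: n => [|n [hsn IH]]; first by exists (not_prime1 hP).
    have hsS : ~ P (s ^+ n.+1) by rewrite exprS; apply: not_primeM.
    exists hsS; rewrite exprS IH loc_mkM; apply: loc_mk_eq.
    by rewrite !exprS.
  have [hsn ->] := mkX q.
  by exists (a ^+ q), (s ^+ q), hsn; split => //; apply: K0.
- by move=> i /iK[iKi _]; apply: extend_ideal.
- move=> i hi; have [? ?] := iK i (ltnW hi); have [? ?] := iK i.+1 hi.
  by apply: extend_proper => //; apply: chK.
Qed.

End Length.
End LocalizationIdeals.

(** * Monomials of the Rees algebra *)

Section Multinomials.
Variable d : nat.
Implicit Types m : 'X_{1..d}.

(** Variables are removed one at a time until the degree has come down to [a]. *)
Lemma mnm_sub_mdeg a m : (a <= mdeg m)%N ->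
  exists2 m', (m' <= m)%MM & mdeg m' = a.
Proof.
have [l] := ubnP (mdeg m - a)%N; elim: l m => // l IH m hl le_am.
have [eq_am|ne_am] := eqVneq a (mdeg m); first by exists m; rewrite ?lepm_refl.
have [i mi] : exists i, m i != 0%N.
  apply/existsP; apply: contraNT ne_am; rewrite negb_exists => /forallP h.
  have m0 : mdeg m = 0%N by rewrite mdegE big1 // => i _; apply/eqP;
    move: (h i); rewrite negbK.
  by move: le_am; rewrite m0 leqn0.
have le_im : (U_(i) <= m)%MM by rewrite lep1mP.
have hm : mdeg m = (mdeg (m - U_(i))%MM).+1.
  by rewrite -[in LHS](submK le_im) mdegD mdeg1 addn1.
have [||m' le_m' <-] := IH (m - U_(i))%MM; [lia|lia|].
exists m' => //; apply: lepm_trans le_m' _.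
by apply/mnm_lepP=> j; rewrite mnmBE leq_subr.
Qed.

Lemma mcoeffM_neq0 (k : fieldType) (f g : {mpoly k[d]}) m :
  (f * g)@_m != 0 ->
  exists m1 m2, [/\ m = (m1 + m2)%MM, f@_m1 != 0 & g@_m2 != 0].
Proof.
move=> h; have [[m1 m2] /= /andP[/eqP -> hm]] : exists m12 : 'X_{1..d} * 'X_{1..d},
    (m == m12.1 + m12.2)%MM && (f@_m12.1 * g@_m12.2 != 0).
  apply: contrapT => /forallNP nex; move/eqP: h; apply.
  rewrite mcoeffM big1 // => i hi; apply/eqP.
  by apply/negP => /negP ne0; apply: (nex (val i.1, val i.2)); rewrite /= hi ne0.
by exists m1, m2; move: hm; rewrite mulf_eq0 negb_or => /andP[].
Qed.

End Multinomials.

Section ReesVeronese.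
Variables (k : fieldType) (d c : nat) (c_gt0 : (0 < c)%N).
Local Notation A := (veronese k d c).
Local Notation vmax := (@veronese_max k d c).
Local Notation S := (rees vmax).
Implicit Types (b : 'X_{1..d}) (n : nat) (f g : S) (v : A).

(** Polynomials supported in degrees divisible by [c] form a subalgebra containing the
    generators. *)
Lemma veronese_supp v b : (veronese_val v)@_b != 0 -> (c %| mdeg b)%N.
Proof.
case: v => h /= /set_mem Ph.
suff : [set h : {mpoly k[d]} | forall b, h@_b != 0 -> (c %| mdeg b)%N] h by apply.
apply: Ph; split; last first.
  move=> _ [m hm ->] b'; rewrite mcoeffX.
  by have [<- _|] := eqVneq m b'; [rewrite hm | rewrite eqxx].
split.
- rewrite inE => b'; rewrite mcoeff1.
  by have [-> _|] := eqVneq b' 0%MM; [rewrite mdeg0 dvdn0 | rewrite eqxx].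
- move=> a x y; rewrite !inE => hx hy b'; rewrite mcoeffD mcoeffZ => h0.
  have [hxb|] := eqVneq (x@_b') 0; last exact: hx.
  by apply: hy; apply: contraNneq h0 => ->; rewrite hxb mulr0 addr0.
- move=> x y; rewrite !inE => hx hy b' /mcoeffM_neq0 [m1 [m2 [-> /hx h1 /hy h2]]].
  by rewrite mdegD dvdn_addr.
Qed.

(** An element of the maximal ideal has no constant term, so its exponents have degree a positive
    multiple of [c]; each factor thus adds at least [c]. *)
Lemma veronese_pow_supp n v b : ideal_pow vmax n v ->
  (veronese_val v)@_b != 0 -> (c * n <= mdeg b)%N.
Proof.
elim: n v b => [|n IH] v b; first by rewrite muln0.
move=> hv; move: v hv b.
pose K : set A := [set v | forall b, (veronese_val v)@_b != 0 -> (c * n.+1 <=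
  mdeg b)%N].
apply: (@ideal_gen_min _ _ K); rewrite /K.
  split => /=.
  - by move=> b; rewrite mcoeff0 eqxx.
  - move=> x y hx hy b; rewrite mcoeffD => h0.
    have [hxb|] := eqVneq ((veronese_val x)@_b) 0; last exact: hx.
    by apply: hy; apply: contraNneq h0 => ->; rewrite hxb addr0.
  - move=> a x hx b /mcoeffM_neq0 [m1 [m2 [-> _ /hx h]]].
    by rewrite mdegD; apply: leq_trans h (leq_addl _ _).
move=> _ [x [y [hx hy ->]]] b /= /mcoeffM_neq0 [m1 [m2 [-> h1 h2]]].
rewrite mdegD mulnS leq_add //; last exact: IH h2.
apply: dvdn_leq; last exact: veronese_supp h1.
rewrite lt0n mdeg_eq0; apply: contra_neq h1 => ->.
exact/veronese_maxP.
Qed.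

(** Divisors of degree [c] are split off repeatedly. There are |b| / c of them, and the same element
    serves every [n] up to that number. *)
Lemma veronese_monomial b : (c %| mdeg b)%N ->
  exists2 v : A, veronese_val v = 'X_[b] &
    forall n, (c * n <= mdeg b)%N -> ideal_pow vmax n v.
Proof.
move=> /dvdnP[j]; rewrite mulnC; elim: j b => [|j IH] b hb.
  have b0 : b = 0%MM by apply/eqP; rewrite -mdeg_eq0 hb muln0.
  exists 1; first by rewrite b0 /= mpolyX0.
  by move=> n; rewrite hb muln0 leqn0 muln_eq0 -leqn0 leqNgt c_gt0 => /eqP ->.
have [|m' le_m' hm'] := @mnm_sub_mdeg _ c b; first by rewrite hb mulnS leq_addr.
have eb := submK le_m'.
have [|w hw hwp] := IH (b - m')%MM.
  by apply/eqP; rewrite -(eqn_add2r (mdeg m')) -mdegD eb hm' hb mulnS addnC.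
have hv : 'X_[m'] \in @veronese_pred k d c.
  by apply/mem_set => B [_]; apply; exists m'.
exists (Veronese hv * w); first by rewrite -[in RHS]eb mpolyXD mulrC /= hw.
case=> [//|n hn]; apply: sub_ideal_gen; exists (Veronese hv), w; split => //.
  by apply: sub_ideal_gen; exists m'.
by apply: hwp; move: hn; rewrite -[in mdeg _]eb mdegD hm' mulnS addnC leq_add2r.
Qed.

Definition rcoef f b n : k := (veronese_val (rees_val f)`_n)@_b.

(* The exponents (b, n) of the monomials x^b t^n of the Rees algebra *)
Definition rees_exp b n := (c %| mdeg b)%N && (c * n <= mdeg b)%N.

Lemma rcoef_inj f g : (forall b n, rcoef f b n = rcoef g b n) -> f = g.
Proof.
move=> h; apply: val_inj; apply/polyP => n; apply: val_inj; apply/mpolyP => b.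
exact: h.
Qed.

Lemma rcoef0 b n : rcoef 0 b n = 0.
Proof. by rewrite /rcoef /= coef0 /= mcoeff0. Qed.

Lemma rcoefD f g b n : rcoef (f + g) b n = rcoef f b n + rcoef g b n.
Proof. by rewrite /rcoef /= coefD /= mcoeffD. Qed.

Lemma rcoefN f b n : rcoef (- f) b n = - rcoef f b n.
Proof. by rewrite /rcoef /= coefN /= mcoeffN. Qed.

Lemma rcoef_sum (I : Type) (r : seq I) (P : pred I) (F : I -> S) b n :
  rcoef (\sum_(i <- r | P i) F i) b n = \sum_(i <- r | P i) rcoef (F i) b n.
Proof.
apply: (big_morph (fun f => rcoef f b n)); first by move=> *; rewrite rcoefD.
by rewrite rcoef0.
Qed.

Lemma rcoef1 b n : rcoef 1 b n = ((b == 0%MM) && (n == 0%N))%:R.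
Proof.
rewrite /rcoef /= coef1; case: n => [|n] /=; last by rewrite andbF mcoeff0.
by rewrite andbT mcoeff1.
Qed.

Lemma rcoef_supp f b n : rcoef f b n != 0 -> rees_exp b n.
Proof.
case: f => f hf; rewrite /rcoef /= => h0.
rewrite /rees_exp (veronese_supp h0) /=.
by move/asboolP: hf => /(_ n) hf; apply: veronese_pow_supp h0.
Qed.

Lemma rcoefM_neq0 f g b n : rcoef (f * g) b n != 0 ->
  exists b1 b2 n1 n2, [/\ b = (b1 + b2)%MM, n = (n1 + n2)%N,
    rcoef f b1 n1 != 0 & rcoef g b2 n2 != 0].
Proof.
rewrite /rcoef /= coefM.
rewrite (big_morph (fun v : A => (veronese_val v)@_b) (id1 := 0) (op1 := +%R))
  => [h0||]; last 2 first.
  by move=> x y; rewrite /= mcoeffD.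
  by rewrite /= mcoeff0.
have [i hi] : exists i : 'I_n.+1,
    (veronese_val (rees_val f)`_i * veronese_val (rees_val g)`_(n - i))@_b != 0.
  apply/existsP; apply: contraNT h0; rewrite negb_exists => /forallP h.
  by rewrite big1 // => i _; apply/eqP; move: (h i); rewrite negbK.
have [m1 [m2 [-> h1 h2]]] := mcoeffM_neq0 hi.
by exists m1, m2, i, (n - i)%N; split=> //; rewrite subnKC // -ltnS.
Qed.

(** The action of [k] is expressed as multiplication by these constants; [I] proves membership in
    the zeroth power of the ideal, which is the whole ring. *)
Definition rees_scalar (a : k) : S := Rees (rees_monomial (I := vmax) (n := 0)
  (a := a%:A) I).

Lemma rees_scalarE a : rees_val (rees_scalar a) = (a%:A : A)%:P.
Proof. by rewrite /= expr0 alg_polyC. Qed.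

Lemma rcoef_scalarM a f b n : rcoef (rees_scalar a * f) b n = a * rcoef f b n.
Proof.
rewrite /rcoef [rees_val _](_ : _ = rees_val (rees_scalar a) * rees_val f) //.
by rewrite rees_scalarE coefCM /= -scalerAl mul1r mcoeffZ.
Qed.

Lemma rees_monomial_ex b n : rees_exp b n ->
  exists f, forall b' n', rcoef f b' n' = ((b' == b) && (n' == n))%:R.
Proof.
move=> /andP[/veronese_monomial [v hv hp] hn].
exists (Rees (rees_monomial (hp n hn))) => b' n'.
rewrite /rcoef /= coefZ coefXn; case: (n' == n); last first.
  by rewrite mulr0 andbF /= mcoeff0.
by rewrite mulr1 andbT hv mcoeffX eq_sym.
Qed.

Lemma rcoef_bound f : exists N, forall b n, rcoef f b n != 0 ->
  (mdeg b < N)%N /\ (n < N)%N.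
Proof.
pose N := (size (rees_val f) + \sum_(i < size (rees_val f))
  msize (veronese_val (rees_val f)`_i)%R)%N.
exists N => b n h0.
have hn : (n < size (rees_val f))%N.
  rewrite ltnNge; apply: contra_neqN h0 => hn.
  by rewrite /rcoef nth_default //= mcoeff0.
split; last exact: leq_trans hn (leq_addr _ _).
have hb := msize_mdeg_lt (_ : b \in msupp (veronese_val (rees_val f)`_n)).
apply: leq_trans (hb _) _; first by rewrite mcoeff_msupp.
by apply: leq_trans (leq_addl _ _); rewrite (bigD1 (Ordinal hn)) //= leq_addr.
Qed.

(** Every element is a finite sum of scalar multiples of the monomials in its support, so an
    additively closed property has to be checked on these alone. *)
Lemma rees_monomial_ind (K : set S) f :
  K 0 -> (forall g h, K g -> K h -> K (g + h)) ->
  (forall a b n g, rcoef f b n != 0 ->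
     (forall b' n', rcoef g b' n' = ((b' == b) && (n' == n))%:R) ->
     K (rees_scalar a * g)) ->
  K f.
Proof.
move=> K0 KD Kmono; have [N hN] := rcoef_bound f.
(* The bound [N] makes the index set finite. Where no monomial exists [sel] is 0, harmlessly, since
   [f] has coefficient 0 there. *)
pose sel (e : 'X_{1..d < N} * 'I_N) : S :=
  if pselect (rees_exp e.1 e.2) is left h then sval (cid (rees_monomial_ex h))
  else 0.
have -> : f = \sum_(e : 'X_{1..d < N} * 'I_N) rees_scalar (rcoef f e.1 e.2) * sel e.
  apply: rcoef_inj => b n; rewrite rcoef_sum.
  under eq_bigr do rewrite rcoef_scalarM.
  have selE (e : 'X_{1..d < N} * 'I_N) : rcoef f e.1 e.2 * rcoef (sel e) b n =
      rcoef f e.1 e.2 * ((b == e.1) && (n == e.2))%:R.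
    have [->|/rcoef_supp he] := eqVneq (rcoef f e.1 e.2) 0; first by rewrite !mul0r.
    rewrite /sel; case: pselect => // h; congr (_ * _).
    by case: cid => g /= ->.
  under eq_bigr do rewrite selE.
  have [h0|/[dup] /hN [hb hn] _] := eqVneq (rcoef f b n) 0.
    rewrite h0 big1 // => -[b' n'] _ /=.
    by case: andP => [[/eqP <- /eqP <-]|]; rewrite ?mulr0 // h0 mul0r.
  rewrite (bigD1 (BMultinom hb, Ordinal hn)) //= !eqxx mulr1 big1 ?addr0 //.
  move=> [b' n'] /= ne; case: andP => [[/eqP eb /eqP en]|]; rewrite ?mulr0 //.
  by case/negP: ne; apply/eqP; congr pair; apply: val_inj; rewrite /= -?eb -?en.
apply: (big_ind K) => // -[b n] _ /=.
have [h0|h0] := eqVneq (rcoef f b n) 0.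
  suff -> : rees_scalar (rcoef f b n) * sel (b, n) = 0 by [].
  by apply: rcoef_inj => *; rewrite h0 rcoef_scalarM rcoef0 mul0r.
apply: (Kmono _ b n) => // b' n'.
rewrite /sel /=; case: pselect => [h|]; last by have := rcoef_supp h0.
by case: cid => g /= ->.
Qed.

End ReesVeronese.

(** * Krull dimension *)

Lemma kernel_prime (B : comNzRingType) (D : idomainType) (phi : {rmorphism B -> D}) :
  prime_ideal [set x | phi x = 0].
Proof.
split=> [|/eqP|x y /= /eqP]; last 2 first.
- by rewrite rmorph1 oner_eq0.
- by rewrite rmorphM mulf_eq0 => /orP[] /eqP; [left | right].
split=> [|x y /=|a x /=]; first exact: rmorph0.
  by rewrite rmorphD => -> ->; rewrite addr0.
by rewrite rmorphM => ->; rewrite mulr0.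
Qed.

(** * Lower bound for the dimension: primes of the coordinate faces *)

Section Faces.
Variables (k : fieldType) (d : nat).

Definition face_subst (T : pred 'I_d) : d.-tuple {mpoly k[d]} :=
  [tuple if T l then 0 else 'X_l | l < d].

Lemma face_subst_coef (T : pred 'I_d) (f : {mpoly k[d]}) b :
  (f \mPo face_subst T)@_b = f@_b * [forall (l | T l), b l == 0%N]%:R.
Proof.
have monE (m : 'X_{1..d}) : \prod_(l < d) tnth (face_subst T) l ^+ m l =
    'X_[m] *+ [forall (l | T l), m l == 0%N] :> {mpoly k[d]}.
  case: forall_inP => [h|/forall_inP].
    rewrite mulr1n mpolyXE_id; apply: eq_bigr => l _; rewrite tnth_mktuple.
    by case: ifP => // /h /eqP ->; rewrite !expr0.
  rewrite negb_forall => /existsP [l]; rewrite negb_imply => /andP[Tl ml].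
  by rewrite mulr0n (bigD1 l) //= tnth_mktuple Tl expr0n (negbTE ml) mul0r.
rewrite comp_mpolyE raddf_sum /= [in RHS](mpolyE f) raddf_sum /= mulr_suml.
apply: eq_bigr => m _; rewrite !mcoeffZ monE mcoeffMn mcoeffX -mulrA.
case: eqP => [->|_]; last by rewrite mul0rn mul0r.
by rewrite mul1r.
Qed.

Lemma face_subst_eq0 (T : pred 'I_d) (f : {mpoly k[d]}) :
  f \mPo face_subst T = 0 <->
  (forall b : 'X_{1..d}, (forall l, T l -> b l = 0%N) -> f@_b = 0).
Proof.
split=> [f0 b hb|h].
  have := face_subst_coef T f b; rewrite f0 mcoeff0.
  suff -> : [forall (l | T l), b l == 0%N] by rewrite mulr1.
  by apply/forall_inP => l /hb ->.
apply/mpolyP => b; rewrite face_subst_coef mcoeff0.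
case: forall_inP => [hb|_]; last by rewrite mulr0.
by rewrite h ?mul0r // => l /hb /eqP.
Qed.

Variables (c : nat).
Local Notation A := (veronese k d c).
Local Notation S := (rees (@veronese_max k d c)).

(** The kernel of setting the variables in [T] to 0, with values in the domain k[x][t];
    [face_ideal0] sets t to 0 as well. *)
Definition face_ideal (T : pred 'I_d) : set S :=
  [set f | forall (b : 'X_{1..d}) n, (forall l, T l -> b l = 0%N) -> rcoef f b n = 0].

Definition face_ideal0 (T : pred 'I_d) : set S :=
  [set f | forall b : 'X_{1..d}, (forall l, T l -> b l = 0%N) -> rcoef f b 0 = 0].

Lemma face_ideal_prime T : prime_ideal (face_ideal T).
Proof.
pose phi : {rmorphism S -> {poly {mpoly k[d]}}} :=
  map_poly (comp_mpoly (face_subst T)) \o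
    map_poly (val : A -> {mpoly k[d]}) \o val.
suff -> : face_ideal T = [set f | phi f = 0] by exact: kernel_prime.
have phiE f n : (phi f)`_n = veronese_val (rees_val f)`_n \mPo face_subst T.
  by rewrite /phi /= coef_map /= coef_map_id0.
apply/seteqP; split=> f h.
  suff : phi f = 0 by [].
  by apply/polyP => n; rewrite phiE coef0; apply/face_subst_eq0 => b hb; exact: h.
have {}h : phi f = 0 := h.
move=> b n; have /face_subst_eq0 h0 :
  veronese_val (rees_val f)`_n \mPo face_subst T = 0 by rewrite -phiE h coef0.
exact: h0.
Qed.

Lemma face_ideal0_prime T : prime_ideal (face_ideal0 T).
Proof.
pose phi : {rmorphism S -> {mpoly k[d]}} :=
  comp_mpoly (face_subst T) \o (val : A -> {mpoly k[d]}) \o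
    horner_eval (0 : A) \o val.
suff -> : face_ideal0 T = [set f | phi f = 0] by exact: kernel_prime.
have phiE f : phi f = veronese_val (rees_val f)`_0 \mPo face_subst T.
  by rewrite /phi /= /horner_eval horner_coef0.
apply/seteqP; split=> f h.
  suff : phi f = 0 by [].
  by rewrite phiE; apply/face_subst_eq0 => b hb; exact: h.
have {}h : phi f = 0 := h.
have /face_subst_eq0 h0 :
  veronese_val (rees_val f)`_0 \mPo face_subst T = 0 by rewrite -phiE h.
by move=> b; exact: h0.
Qed.

Hypothesis c_gt0 : (0 < c)%N.

Lemma rees_max_rcoef (f : S) : rees_max f <-> rcoef f 0 0 = 0.
Proof. by rewrite rees_maxP ?veronese_maxP //; apply: ideal_gen_ideal. Qed.

(* The faces killed by x_1, ..., x_i for i < d; then t is killed as well, and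
   x_d comes last, since x_d^c t is in the Rees algebra but t is not. *)
Lemma rees_prime_chain : (0 < d)%N -> exists Q : nat -> set S,
  [/\ forall i, (i <= d.+1)%N -> prime_ideal (Q i),
      forall i, (i < d.+1)%N -> Q i `<` Q i.+1
    & Q d.+1 `<=` @rees_max _ _].
Proof.
move=> d_gt0.
pose T i := [pred l : 'I_d | l < i]%N.
(* Index [d] has the same variables as index [d.-1] and adds t; this is the shift in [i.-1]. *)
pose Q i := if (i < d)%N then face_ideal (T i) else face_ideal0 (T i.-1).
(* Strictness is witnessed by x_l^c, and by x_l^c t at the step where t is killed. *)
have mon (l : 'I_d) n : (n <= 1)%N -> exists f : S,
    forall b' n', rcoef f b' n' = ((b' == (U_(l) *+ c)%MM) && (n' == n))%:R.
  move=> hn; apply: rees_monomial_ex => //.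
  by rewrite /rees_exp mdegMn mdeg1 mul1n dvdnn -[X in (_ <= X)%N]muln1
    leq_mul2l hn orbT.
have Uc (l l' : 'I_d) : (U_(l) *+ c)%MM l' = ((l == l') * c)%N.
  by rewrite mulmnE mnm1E.
exists Q; split=> [i _|i hi|].
- rewrite /Q; case: ifP => _; [exact: face_ideal_prime | exact: face_ideal0_prime].
- have [hid|hid|hid] := ltngtP i.+1 d.
  + rewrite /Q hid (ltnW hid); split.
      by move=> f h b n hb; apply: h => l /= hl; apply: hb; apply: leq_trans hl _.
    have [f hf] := mon (Ordinal (ltnW hid)) 0%N isT.
    move=> /(_ f) hQ; have /hQ : face_ideal (T i.+1) f.
      move=> b n /(_ (Ordinal (ltnW hid)) (ltnSn i)) hb.
      rewrite hf; case: eqP => //= eb; move: hb; rewrite eb Uc eqxx mul1n => hc.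
      by move: c_gt0; rewrite hc.
    move/(_ (U_(Ordinal (ltnW hid)) *+ c)%MM 0%N); rewrite hf !eqxx /= => h0.
    suff /eqP : 1 = 0 :> k by rewrite oner_eq0.
    apply: h0 => l /= hl; rewrite Uc.
    by case: eqP => // el; move: hl; rewrite -el ltnn.
  + have ed : i = d by apply/eqP; rewrite eqn_leq -ltnS hi -ltnS hid.
    rewrite /Q ed ltnn ltnNge leqnSn /=; split.
      move=> f h b hb; apply: h => l /= hl; apply: hb; apply: leq_trans hl _.
      exact: leq_pred.
    have hl : (d.-1 < d)%N by rewrite prednK.
    have [f hf] := mon (Ordinal hl) 0%N isT.
    move=> /(_ f) hQ; have /hQ : face_ideal0 (T d) f.
      move=> b /(_ (Ordinal hl) hl) hb.
      rewrite hf; case: eqP => //= eb; move: hb; rewrite eb Uc eqxx mul1n => hc.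
      by move: c_gt0; rewrite hc.
    move/(_ (U_(Ordinal hl) *+ c)%MM); rewrite hf !eqxx /= => h0.
    suff /eqP : 1 = 0 :> k by rewrite oner_eq0.
    apply: h0 => l /= hl'; rewrite Uc.
    by case: eqP => // el; move: hl'; rewrite -el /= ltnn.
  + have hid' : (i < d)%N by rewrite -hid.
    have hid2 : (i.+1 < d)%N = false by rewrite hid ltnn.
    rewrite /Q hid' hid2 /=; split; first by move=> f h b hb; apply: h.
    have [f hf] := mon (Ordinal hid') 1%N isT.
    move=> /(_ f) hQ; have /hQ : face_ideal0 (T i) f.
      by move=> b _; rewrite hf andbF.
    move/(_ (U_(Ordinal hid') *+ c)%MM 1%N); rewrite hf !eqxx /= => h0.
    suff /eqP : 1 = 0 :> k by rewrite oner_eq0.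
    apply: h0 => l /= hl; rewrite Uc.
    by case: eqP => // el; move: hl; rewrite -el ltnn.
- rewrite /Q ltnNge leqnSn /= => f h; apply/rees_max_rcoef; apply: h => l _.
  by rewrite mnm0E.
Qed.

End Faces.

(** * Cubes of exponent lists and linear dependence *)

(** Plain lists let sums over the cube unfold one coordinate at a time. *)
Fixpoint cube (m N : nat) : seq (seq nat) :=
  if m is m'.+1 then [seq x :: s | x <- iota 0 N, s <- cube m' N] else [:: [::]].

Lemma mem_cube m N s :
  (s \in cube m N) = (size s == m) && all (fun x => x < N)%N s.
Proof.
elim: m s => [|m IH] [|x s] //=.
  by apply/allpairsP => -[[y t] []].
apply/allpairsP/andP => [[[y t] /= [hy ht [-> ->]]]|[hs /andP[hx hall]]].
  move: ht hy; rewrite IH mem_iota => /andP[/eqP -> ht] /andP[_ hy].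
  by split=> //; apply/andP.
by exists (x, s); rewrite /= mem_iota hx IH -eqSS hs hall.
Qed.

Lemma cube_uniq m N : uniq (cube m N).
Proof.
elim: m => [|m IH] //=; apply: allpairs_uniq => //; first exact: iota_uniq.
by move=> [x s] [y t] _ _ /= [-> ->].
Qed.

Lemma size_cube m N : size (cube m N) = (N ^ m)%N.
Proof. by elim: m => [|m IH] //=; rewrite size_allpairs size_iota IH expnS. Qed.

Lemma big_cubeS (V : nmodType) m N (F : seq nat -> V) :
  \sum_(s <- cube m.+1 N) F s =
  \sum_(0 <= x < N) \sum_(s <- cube m N) F (x :: s).
Proof. by rewrite big_allpairs_dep /index_iota subn0. Qed.

Lemma big_cube0 (V : nmodType) N (F : seq nat -> V) :
  \sum_(s <- cube 0 N) F s = F [::].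
Proof. by rewrite big_seq1. Qed.

(** With more vectors than coordinates the matrix has no full row rank, and a nonzero vector of its
    left kernel gives the coefficients. *)
Lemma linear_dependence (k : fieldType) (I J : eqType) (rI : seq I)
    (rJ : seq J) (v : I -> J -> k) : uniq rI -> (size rJ < size rI)%N ->
  exists lam : I -> k, (exists2 i, i \in rI & lam i != 0) /\
    forall j, j \in rJ -> \sum_(i <- rI) lam i * v i j = 0.
Proof.
move=> uI lt_JI.
have [i0 _] : exists i0, i0 \in rI by case: rI lt_JI {uI} => // i r _;
  exists i; rewrite mem_head.
case: rJ lt_JI => [|j0 rJ'].
  move=> lt0; exists (fun=> 1); split=> //.
  by case: rI lt0 {uI} => // i r _; exists i; rewrite ?mem_head ?oner_neq0.
set rJ := j0 :: rJ' => lt_JI.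
pose M : 'M[k]_(size rI, size rJ) := \matrix_(i, j) v (nth i0 rI i) (nth j0 rJ j).
have kerM : kermx M != 0.
  rewrite kermx_eq0 /row_free neq_ltn; apply/orP; left.
  by apply: leq_ltn_trans (rank_leq_col M) lt_JI.
have [u uM u0] := rowV0Pn kerM.
move/sub_kermxP: uM => uM.
(* Coefficients are read off at the position in [rI], with 0 outside the list. *)
exists (fun i => oapp (u 0) 0 (insub (index i rI))); split.
  have /existsP [i ui] : [exists i, u 0 i != 0].
    apply: contraNT u0; rewrite negb_exists => /forallP h.
    by apply/eqP/rowP => i; rewrite mxE; apply/eqP; rewrite -[_ == _]negbK h.
  by exists (nth i0 rI i); rewrite ?mem_nth // index_uniq // valK.
move=> j hj; rewrite (big_nth i0) big_mkord.
have hj' : (index j rJ < size rJ)%N by rewrite index_mem.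
have := congr1 (fun w : 'rV_(size rJ) => w 0 (Ordinal hj')) uM.
rewrite !mxE => e; rewrite -[RHS]e; apply: eq_bigr => i _.
by rewrite index_uniq // valK /= mxE /= nth_index.
Qed.

(** * Upper bound for the dimension: independence along a chain of primes *)

Section ChainIndependence.
Variables (B : comNzRingType) (N : nat).
Implicit Types (fs : seq B) (P : nat -> set B).

Fixpoint power_product fs (s : seq nat) : B :=
  match fs, s with
  | f :: fs', r :: s' => f ^+ r * power_product fs' s'
  | _, _ => 1
  end.

(* The relation is divided by the largest power of f_0 it contains; modulo
   P_1 this removes f_0 from it. *)
Lemma prime_chain_independence fs P (a : seq nat -> B) :
  (forall i, (i <= size fs)%N -> prime_ideal (P i)) ->
  (forall i, (i < size fs)%N ->
     [/\ P i `<=` P i.+1, P i.+1 fs`_i & ~ P i fs`_i]) ->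
  (forall s, a s = 0 \/ ~ P (size fs) (a s)) ->
  P 0%N (\sum_(s <- cube (size fs) N) a s * power_product fs s) ->
  forall s, s \in cube (size fs) N -> a s = 0.
Proof.
elim: fs P a => [|f fs IH] P a pP hP ha.
  rewrite big_cube0 mulr1 => Pa s; rewrite inE => /eqP ->.
  by case: (ha [::]).
pose g r := \sum_(s <- cube (size fs) N) a (r :: s) * power_product fs s.
have -> : \sum_(s <- cube (size (f :: fs)) N) a s * power_product (f :: fs) s =
    \sum_(0 <= r < N) f ^+ r * g r.
  rewrite big_cubeS; apply: eq_bigr => r _; rewrite mulr_sumr.
  by apply: eq_bigr => s _; rewrite mulrCA.
move=> P0sum.
have [P01 P1f nP0f] := hP 0%N isT; have [iP0 P01' mP0] := pP 0%N isT.
have [iP1 _ _] := pP 1%N isT; have [_ _ hM1] := iP1; have [_ hD1 _] := iP1.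
have key r : (r < N)%N -> forall s, s \in cube (size fs) N -> a (r :: s) = 0.
  elim/ltn_ind: r => r IHr ltrN.
  apply: (IH (fun i => P i.+1) (fun s => a (r :: s))).
  - by move=> i hi; apply: pP.
  - by move=> i hi; apply: (hP i.+1).
  - by move=> s; apply: ha.
  have g0 r' : (r' < r)%N -> g r' = 0.
    move=> lt; rewrite /g big_seq big1 // => s hs.
    by rewrite (IHr _ lt) ?mul0r // (ltn_trans lt).
  (* With the layers below [r] gone, f^r factors out; [f] is not in P_0, so the cofactor is, and
     modulo P_1 it reduces to [g r]. *)
  have [h eh] : exists h, \sum_(0 <= r' < N) f ^+ r' * g r' =
      f ^+ r * (g r + f * h).
    exists (\sum_(r.+1 <= r' < N) f ^+ (r' - r.+1) * g r').
    rewrite (big_cat_nat (n := r)) //= 1?ltnW // big_nat big1 ?add0r; last first.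
      by move=> i /andP[_ /g0 ->]; rewrite mulr0.
    rewrite big_ltn // mulrDr; congr (_ + _).
    rewrite mulrA -exprSr mulr_sumr big_nat_cond [RHS]big_nat_cond.
    apply: eq_bigr => i /andP[/andP[hi _] _].
    by rewrite mulrA -exprD subnKC.
  move: P0sum; rewrite eh.
  have nPX n : ~ P 0%N (f ^+ n).
    by elim: n => [|n IHn]; rewrite ?expr0 // exprS => /mP0[].
  move=> /mP0 [/nPX//|/P01 hg]; rewrite -/(g r).
  have -> : g r = (g r + f * h) - h * f by rewrite (mulrC h) addrK.
  by apply: hD1 => //; apply: is_idealN => //; apply: hM1.
move=> [|r s]; rewrite mem_cube //= => /andP[hs /andP[hr hall]].
by apply: key => //; rewrite mem_cube -eqSS hs.
Qed.

End ChainIndependence.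

Section DimensionBound.
Variables (k : fieldType) (d c : nat) (c_gt0 : (0 < c)%N).
Local Notation S := (rees (@veronese_max k d c)).

Definition mnm_of_seq (s : seq nat) : 'X_{1..d} := [multinom nth 0%N s i | i < d].

Lemma mnm_of_seqK (b : 'X_{1..d}) : mnm_of_seq b = b.
Proof. by apply/mnmP => i; rewrite mnmE -mnm_nth. Qed.

Lemma seq_of_mnmK (s : seq nat) : size s = d -> mnm_of_seq s = s :> seq nat.
Proof.
move=> hs; apply: (@eq_from_nth _ 0%N); first by rewrite size_tuple.
by move=> i; rewrite size_tuple => hi; rewrite -(mnm_nth 0%N _ (Ordinal hi)) mnmE.
Qed.

Lemma mdeg_mnm_of_seq (s : seq nat) : size s = d -> mdeg (mnm_of_seq s) = sumn s.
Proof. by move=> hs; rewrite /mdeg seq_of_mnmK // sumnE. Qed.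

Lemma mnm_le_mdeg (b : 'X_{1..d}) i : (b i <= mdeg b)%N.
Proof. by rewrite mdegE (bigD1 i) //= leq_addr. Qed.

Lemma mnm_cube (b : 'X_{1..d}) N : (mdeg b < N)%N -> (b : seq nat) \in cube d N.
Proof.
move=> hb; rewrite mem_cube size_tuple eqxx; apply/(all_nthP 0%N) => i.
rewrite size_tuple => hi; rewrite -(mnm_nth 0%N _ (Ordinal hi)).
exact: leq_ltn_trans (mnm_le_mdeg _ _) hb.
Qed.

Lemma rees_scalar_unit (a : k) (P : set S) :
  prime_ideal P -> a != 0 -> ~ P (rees_scalar d c a).
Proof.
move=> [[_ _ hM] P1 _] a0 Pa; apply: P1.
suff -> : 1 = rees_scalar d c a^-1 * rees_scalar d c a by apply: hM.
apply: rcoef_inj => b n; rewrite -[X in rcoef (_ * X)]mulr1 !rcoef_scalarM.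
by rewrite mulrA mulVf // mul1r.
Qed.

Lemma rees_scalar0 : rees_scalar d c (0 : k) = 0.
Proof.
apply: rcoef_inj => b n; rewrite -[X in rcoef X]mulr1 rcoef_scalarM mul0r.
by rewrite rcoef0.
Qed.

Lemma power_product_bound (D N : nat) (fs : seq S) s :
  (forall f, f \in fs -> forall b n, rcoef f b n != 0 ->
     (mdeg b <= D)%N /\ (n <= D)%N) ->
  all (fun x => x < N)%N s ->
  forall b n, rcoef (power_product fs s) b n != 0 ->
    (mdeg b <= D * N * size fs)%N /\ (n <= D * N * size fs)%N.
Proof.
have r1 b n : rcoef (1 : S) b n != 0 -> mdeg b = 0%N /\ n = 0%N.
  rewrite rcoef1; case: andP => [[/eqP -> /eqP ->]|]; last by rewrite eqxx.
  by rewrite mdeg0.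
elim: fs s => [|f fs IH] [|r s] hfs hs b n /=; try by move=> /r1 [-> ->].
move=> /rcoefM_neq0 [b1 [b2 [n1 [n2 [-> -> h1 h2]]]]].
move: hs => /= /andP[hr hs].
have [hb2 hn2] := IH s (fun g hg => hfs g (@mem_behead _ (f :: fs) _ hg)) hs b2 n2 h2.
have {h1} [hb1 hn1] : (mdeg b1 <= D * r)%N /\ (n1 <= D * r)%N.
  elim: (r) b1 n1 h1 => [|r' IHr] b1 n1; first by rewrite expr0 => /r1 [-> ->].
  rewrite exprS => /rcoefM_neq0 [b3 [b4 [n3 [n4 [-> -> h3 h4]]]]].
  have [? ?] := hfs f (mem_head _ _) _ _ h3; have [? ?] := IHr _ _ h4.
  by rewrite mdegD !mulnS; lia.
have : (D * r <= D * N)%N by rewrite leq_mul2l (ltnW hr) orbT.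
by rewrite mdegD mulnS; lia.
Qed.

(* Otherwise there would be d + 2 algebraically independent elements; but the
   exponents of the N^(d+2) products of their powers are in a cube of size
   O(N)^(d+1). *)
Lemma rees_prime_chain_bound n (Q : nat -> set S) :
  (forall i, (i <= n)%N -> prime_ideal (Q i)) ->
  (forall i, (i < n)%N -> Q i `<` Q i.+1) -> (n <= d.+1)%N.
Proof.
move=> pQ chQ; rewrite leqNgt; apply/negP => lt_dn.
(* Elements separating consecutive primes, with 0 out of range. *)
pose f i : S := if pselect (exists x, Q i.+1 x /\ ~ Q i x) is left h
  then sval (cid h) else 0.
have fP i : (i < n)%N -> Q i.+1 (f i) /\ ~ Q i (f i).
  move=> hi; rewrite /f; case: pselect => [h|]; first by case: cid.
  case; have [_ h] := chQ i hi; apply: contrapT => /forallNP h'; apply: h => x Qx.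
  by apply: contrapT => nQ; apply: (h' x).
pose fs := mkseq f d.+2.
have [D hD] : exists D, forall g, g \in fs -> forall b n, rcoef g b n != 0 ->
    (mdeg b <= D)%N /\ (n <= D)%N.
  elim: fs => [|g fs' [D hD]]; first by exists 0%N.
  have [N hN] := rcoef_bound g; exists (maxn D N) => h.
  rewrite inE => /predU1P[-> b m /hN|/hD hh b m /hh]; lia.
(* Chosen so that M^(d+1) <= ((D (d + 2) + 1) N)^(d+1) < N^(d+2): the exponents in [J] are fewer
   than the products of powers. *)
pose N := (((D * d.+2).+1 ^ d.+1).+1)%N.
pose M := (D * N * d.+2).+1%N.
have szfs : size fs = d.+2 by rewrite size_mkseq.
pose J := [seq (b, m) | b <- cube d M, m <- iota 0 M].
have [||lam [[s0 hs0 lam0] hlam]] := @linear_dependence k _ _ (cube d.+2 N) J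
    (fun s j => rcoef (power_product fs s) (mnm_of_seq j.1) j.2).
- exact: cube_uniq.
- rewrite size_cube size_allpairs size_cube size_iota -expnSr.
  have hM : (M <= (D * d.+2).+1 * N)%N by rewrite /M /N; lia.
  apply: leq_ltn_trans (_ : (((D * d.+2).+1 * N) ^ d.+1 < _)%N).
    by rewrite leq_exp2r.
  by rewrite expnMn [X in (_ < X)%N]expnS ltn_mul2r expn_gt0 /= /N ltnSn.
case/eqP: lam0.
have a0 : rees_scalar d c (lam s0) = 0.
  apply: (@prime_chain_independence _ N fs Q (fun s => rees_scalar d c (lam s)));
    rewrite ?szfs //.
  - by move=> i hi; apply: pQ; apply: leq_trans hi lt_dn.
  - move=> i hi; have hin := leq_trans hi lt_dn.
    have [? ?] := fP i hin; rewrite nth_mkseq //; split=> //.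
    by case: (chQ i hin).
  - move=> s; have [->|h] := eqVneq (lam s) 0; first by left; exact: rees_scalar0.
    by right; apply: rees_scalar_unit => //; apply: pQ.
  suff -> : \sum_(s <- cube d.+2 N) rees_scalar d c (lam s) * power_product fs s = 0.
    by case: (pQ 0%N isT) => -[].
  apply: rcoef_inj => b m; rewrite rcoef_sum rcoef0.
  under eq_bigr do rewrite rcoef_scalarM.
  have [hbm|hbm] := boolP ((mdeg b < M) && (m < M))%N.
    have := hlam (b : seq nat, m); rewrite /= mnm_of_seqK; apply.
    have [hb hm] := andP hbm.
    by apply/allpairsP; exists (b : seq nat, m); rewrite mnm_cube // mem_iota.
  rewrite big_seq big1 // => s; rewrite mem_cube => /andP[_ hs].
  have [->|h0] := eqVneq (rcoef (power_product fs s) b m) 0; first by rewrite mulr0.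
  have [] := power_product_bound hD hs h0; rewrite szfs => hb hm.
  by move: hbm; rewrite /M !ltnS hb hm.
have := congr1 (fun x : S => rcoef x 0%MM 0%N) a0.
by rewrite -[X in rcoef X]mulr1 rcoef_scalarM rcoef1 rcoef0 !eqxx mulr1.
Qed.

End DimensionBound.

(** * Length modulo the Frobenius powers *)

Section FrobeniusLength.
Variables (k : fieldType) (d c : nat) (c_gt0 : (0 < c)%N).
Local Notation S := (rees (@veronese_max k d c)).
Local Notation M := (@rees_max _ (@veronese_max k d c)).
Implicit Types (b : 'X_{1..d}) (n : nat) (f g : S).

Definition is_monomial f b n :=
  forall b' n', rcoef f b' n' = ((b' == b) && (n' == n))%:R.

Lemma is_monomialM f g b1 n1 b2 n2 : is_monomial f b1 n1 ->
  is_monomial g b2 n2 -> is_monomial (f * g) (b1 + b2)%MM (n1 + n2).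
Proof.
have monE h b n : is_monomial h b n ->
    rees_val h = (rees_val h)`_n *: 'X^n /\ veronese_val (rees_val h)`_n = 'X_[b].
  move=> hh; split; last first.
    apply/mpolyP => b'; rewrite mcoeffX [LHS]hh eqxx andbT eq_sym //.
  apply/polyP => n'; rewrite coefZ coefXn; case: eqP => [->|/eqP ne].
    by rewrite mulr1.
  rewrite mulr0; apply: val_inj; apply/mpolyP => b'; rewrite /= mcoeff0 [LHS]hh.
  by rewrite (negbTE ne) andbF.
move=> /monE [ef vf] /monE [eg vg] b' n'; rewrite /rcoef /= ef eg.
rewrite -scalerAl -scalerAr scalerA -exprD coefZ coefXn.
case: (n' == _); last by rewrite mulr0 /= mcoeff0 andbF.
by rewrite mulr1 andbT /= vf vg -mpolyXD mcoeffX eq_sym.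
Qed.

Lemma is_monomialX f b n q : is_monomial f b n ->
  is_monomial (f ^+ q) (b *+ q)%MM (q * n).
Proof.
move=> hf; elim: q => [|q IH].
  by move=> b' n'; rewrite expr0 rcoef1 mulm0n mul0n.
by rewrite exprS mulmS mulSn; apply: is_monomialM.
Qed.

Lemma is_monomial_inj f g b n : is_monomial f b n -> is_monomial g b n -> f = g.
Proof. by move=> hf hg; apply: rcoef_inj => b' n'; rewrite hf hg. Qed.

(** For b = 0 the inequality c n <= |b| forces n = 0. *)
Lemma rees_exp_gt0 b n : rees_exp c b n -> (b != 0%MM) || (n != 0%N) ->
  (c <= mdeg b)%N.
Proof.
move=> /andP[h1 h2] ne; apply: dvdn_leq h1; rewrite lt0n mdeg_eq0.
apply: contraTN ne => /eqP b0; move: h2; rewrite b0 mdeg0 leqn0 muln_eq0.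
by rewrite eqxx /= gtn_eqF //= negbK.
Qed.

Variable q : nat.
Hypothesis q_gt0 : (0 < q)%N.

(* The exponents of the monomials of M^[q]: with x^(q a) dividing x^b for some
   a of degree c, either (x^a)^q or (x^a t)^q divides x^b t^n. *)
Definition frob_exp b n :=
  (c <= \sum_i b i %/ q)%N && ((c * (n + q) <= mdeg b) || (q <= n))%N.

(** Makes [frob_vanishing] an ideal: floors never decrease, and c n2 <= |b2| preserves the
    inequality c (n + q) <= |b|. *)
Lemma frob_expD b1 n1 b2 n2 : frob_exp b1 n1 -> rees_exp c b2 n2 ->
  frob_exp (b1 + b2)%MM (n1 + n2).
Proof.
move=> /andP[h1 h2] /andP[_ h3]; apply/andP; split.
  apply: leq_trans h1 _; apply: leq_sum => i _.
  by rewrite leq_div2r // mnmDE leq_addr.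
case/orP: h2 => h2; apply/orP; [left | right];
  last exact: leq_trans h2 (leq_addr _ _).
by rewrite addnAC mulnDr mdegD leq_add.
Qed.

Definition vanishing (T : seq ('X_{1..d} * nat)) : set S :=
  [set f | forall e, e \in T -> rcoef f e.1 e.2 = 0].

Definition frob_vanishing : set S :=
  [set f | forall b n, ~~ frob_exp b n -> rcoef f b n = 0].

Lemma frob_vanishing_ideal : is_ideal frob_vanishing.
Proof.
split=> [b n _|f g hf hg b n hbn|f g hg b n hbn]; first by rewrite rcoef0.
  by rewrite rcoefD hf // hg // addr0.
apply/eqP; apply: contraNT hbn => /rcoefM_neq0 [b1 [b2 [n1 [n2 [-> -> h1 h2]]]]].
rewrite addmC addnC; apply: frob_expD; last exact: rcoef_supp h1.
by apply: contraNT h2 => /hg ->.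
Qed.

(** For a monomial x^b t^n, the floors of b_i / q dominate some beta of degree c, and (x^beta
    t^nu)^q is divided out, with nu = 1 if q <= n and nu = 0 otherwise. *)
Lemma mem_frob_power f : frob_vanishing f -> frob_power M q f.
Proof.
move=> hf; have [h0 hD hM] := ideal_gen_ideal [set x ^+ q | x in M].
apply: (rees_monomial_ind c_gt0) => // a b n g fbn hg; apply: (hM).
have /andP[dvd_b le_nb] := rcoef_supp c_gt0 fbn.
have /andP[hfl hor] : frob_exp b n by apply: contraNT fbn => /hf ->.
have [|beta le_beta hbeta] := @mnm_sub_mdeg _ c [multinom b i %/ q | i < d].
  by rewrite mdegE; under eq_bigr do rewrite mnmE.
have le_qb : (beta *+ q <= b)%MM.
  apply/mnm_lepP => i; rewrite mulmnE; move/mnm_lepP: le_beta => /(_ i).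
  by rewrite mnmE => h; apply: leq_trans (leq_divM _ q); rewrite leq_mul2r h orbT.
have eb := submK le_qb.
have hdeg : mdeg b = (mdeg (b - beta *+ q)%MM + c * q)%N.
  by rewrite -[in LHS]eb mdegD mdegMn hbeta.
have exp_beta nu : (nu <= 1)%N -> rees_exp c beta nu.
  by move=> h; rewrite /rees_exp hbeta dvdnn -[X in (_ <= X)%N]muln1 leq_mul2l h orbT.
have dvd_r : (c %| mdeg (b - beta *+ q)%MM)%N.
  by move: dvd_b; rewrite hdeg dvdn_addl ?dvdn_mulr.
have key nu : (nu <= 1)%N -> (q * nu <= n)%N ->
    (c * (n - q * nu) <= mdeg (b - beta *+ q)%MM)%N -> ideal_gen [set x ^+ q |
      x in M] g.
  move=> hnu hqn hle.
  have [u hu] := rees_monomial_ex k c_gt0 (exp_beta _ hnu).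
  have [|w hw] := @rees_monomial_ex k d c c_gt0 (b - beta *+ q)%MM (n - q * nu)%N.
    by rewrite /rees_exp dvd_r.
  have -> : g = w * u ^+ q.
    apply: is_monomial_inj hg _; have := is_monomialM hw (is_monomialX q hu).
    by rewrite eb subnK.
  apply: hM; apply: sub_ideal_gen; exists u => //.
  apply/(rees_max_rcoef c_gt0); rewrite hu; case: eqP => // e0.
  by move: c_gt0; rewrite -hbeta -e0 mdeg0.
have [le_qn|lt_nq] := leqP q n.
  apply: (key 1%N); rewrite ?muln1 //.
  by rewrite mulnBr leq_subLR addnC -hdeg.
apply: (key 0%N); rewrite ?muln0 // subn0.
by case/orP: hor => [|h]; [rewrite mulnDr hdeg leq_add2r | lia].
Qed.

Lemma rcoefMn f m b n : rcoef (f *+ m) b n = rcoef f b n *+ m.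
Proof. by elim: m => [|m IH]; rewrite ?mulr0n ?rcoef0 // !mulrS rcoefD IH. Qed.

Lemma rees_pchar p : p \in [pchar k] -> p \in [pchar S].
Proof.
move=> hp; rewrite inE (pcharf_prime hp) /=; apply/eqP; apply: rcoef_inj => b n.
by rewrite rcoefMn rcoef0 (mulrn_pchar hp).
Qed.

(** In characteristic p the q-th power is additive and acts term by term. A nonconstant monomial has
    |b| >= c, which is the floor condition for q b, and q n is either 0 or at least q. *)
Lemma rees_max_frob p f : p \in [pchar k] -> p.-nat q -> M f ->
  frob_vanishing (f ^+ q).
Proof.
move=> hp pq /(rees_max_rcoef c_gt0) f0.
have [h0 hD hM] := frob_vanishing_ideal.
apply: (@rees_monomial_ind _ _ _ c_gt0 [set f | frob_vanishing (f ^+ q)] f).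
- by rewrite /mkset expr0n gtn_eqF.
- move=> g h hg hh; rewrite /mkset (@exprDn_pchar S); first exact: hD.
  by rewrite (eq_pnat _ (pcharf_eq (rees_pchar hp))).
move=> a b n g fbn hg; rewrite /mkset exprMn; apply: (hM) => b' n'.
rewrite (is_monomialX q hg); case: andP => // -[/eqP -> /eqP ->].
case/negP; have ebn := rcoef_supp c_gt0 fbn.
have le_cb : (c <= mdeg b)%N.
  apply: rees_exp_gt0 ebn _; rewrite -negb_and.
  by apply: contra_neqN fbn => /andP[/eqP -> /eqP ->].
apply/andP; split.
  by under eq_bigr do rewrite mulmnE mulnK //; rewrite -mdegE.
case: n {fbn hg ebn} => [|n]; last by rewrite mulnS leq_addr orbT.
by rewrite muln0 add0n mdegMn leq_mul2r le_cb orbT.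
Qed.

(** * Chains of ideals above M^[q] *)

Section Chains.
Variable E : seq ('X_{1..d} * nat).
Hypothesis E_uniq : uniq E.
Hypothesis mem_E : forall e,
  (e \in E) = rees_exp c e.1 e.2 && ~~ frob_exp e.1 e.2.

(** If the chain is too long, some combination of elements [g i] separating its members has no
    coefficient in [E], hence lies in M^[q] and in [K 0]. *)
Lemma frob_chain_bound n (K : nat -> set S) :
  frob_power M q `<=` K 0%N -> (forall i, (i <= n)%N -> is_ideal (K i)) ->
  (forall i, (i < n)%N -> K i `<` K i.+1) -> (n <= size E)%N.
Proof.
move=> K0 iK chK; rewrite leqNgt; apply/negP => lt_En.
pose g i : S := if pselect (exists x, K i.+1 x /\ ~ K i x) is left h
  then sval (cid h) else 0.
have gP i : (i < n)%N -> K i.+1 (g i) /\ ~ K i (g i).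
  move=> hi; rewrite /g; case: pselect => [h|]; first by case: cid.
  case; have [_ h] := chK i hi; apply: contrapT => /forallNP h'; apply: h => x Kx.
  by apply: contrapT => nK; apply: (h' x).
have [||lam [[i0 hi0 lam0] hlam]] := @linear_dependence k _ _ (iota 0 n) E
    (fun i e => rcoef (g i) e.1 e.2); first exact: iota_uniq.
  by rewrite size_iota.
have sum0 : K 0%N (\sum_(i <- iota 0 n) rees_scalar d c (lam i) * g i).
  apply: K0; apply: mem_frob_power => b m hbm; rewrite rcoef_sum.
  under eq_bigr do rewrite rcoef_scalarM.
  have [hexp|hexp] := boolP (rees_exp c b m).
    by apply: (hlam (b, m)); rewrite mem_E hexp.
  rewrite big1 // => i _; rewrite [rcoef _ _ _](_ : _ = 0) ?mulr0 //.
  by apply/eqP; apply: contraNT hexp; apply: rcoef_supp.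
have exP : exists i, (i < n)%N && (lam i != 0).
  by exists i0; rewrite lam0 andbT; move: hi0; rewrite mem_iota.
(* For the last index with a nonzero coefficient, all other terms lie in [K i], and so would
   [g i]. *)
have [|i /andP[hi lami] maxi] := ex_maxnP exP (m := n).
  by move=> i /andP[/ltnW].
have [_ []] := gP i hi; have [h0 hD hM] := iK i (ltnW hi).
have Kle j : (j <= i)%N -> K j `<=` K i.
  move=> hj; apply: (proper_chain_sub chK); rewrite hj (ltnW hi) //.
have -> : g i = rees_scalar d c (lam i)^-1 * (rees_scalar d c (lam i) * g i).
  by apply: rcoef_inj => b m; rewrite !rcoef_scalarM mulrA mulVf // mul1r.
apply: (hM); have hin : i \in iota 0 n by rewrite mem_iota.
move: sum0; rewrite (bigD1_seq i) ?iota_uniq //=.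
set r := \sum_(_ <- _ | _) _ => sum0.
have Kr : K i r.
  rewrite /r big_seq_cond; apply: big_ind => // j /andP[];
    rewrite mem_iota => /andP[_ hj] nji.
  have [lamj|lamj] := eqVneq (lam j) 0.
    by rewrite lamj rees_scalar0 mul0r.
  apply: (hM); apply: (Kle j.+1); last by case: (gP j hj).
  by rewrite ltn_neqAle nji maxi // hj.
rewrite -[X in K i X](addrK r); apply: (hD); first exact: (Kle 0%N).
exact: is_idealN (iK i (ltnW hi)) Kr.
Qed.

(** Multiplication by a nonconstant monomial strictly raises this degree, whatever the order chosen
    among equal weights. *)
Let weight (e : 'X_{1..d} * nat) := (mdeg e.1 + e.2)%N.
Let Es := sort (relpre weight leq) E.

Let mem_Es e : (e \in Es) = (e \in E). Proof. by rewrite mem_sort. Qed.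
Let size_Es : size Es = size E. Proof. by rewrite size_sort. Qed.
Let Es_uniq : uniq Es. Proof. by rewrite sort_uniq. Qed.

Let take_down m e e' : e \in take m Es -> e' \in E -> (weight e' < weight e)%N ->
  e' \in take m Es.
Proof.
move=> he; rewrite -mem_Es -{1}(cat_take_drop m Es) mem_cat => /orP[//|he'].
have : pairwise (relpre weight leq) Es.
  rewrite -sorted_pairwise; last by move=> x y z; apply: leq_trans.
  by apply: sort_sorted => x y; apply: leq_total.
rewrite -{1}(cat_take_drop m Es) pairwise_cat => /and3P[/allrelP /(_ _ _ he he')].
by rewrite /= leqNgt => /negbTE ->.
Qed.

Let not_frob f g e b1 n1 b2 n2 : e \in E -> e = ((b1 + b2)%MM, (n1 + n2)%N) ->
  rcoef f b1 n1 != 0 -> rcoef g b2 n2 != 0 -> (b2, n2) \in E.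
Proof.
move=> + ee h1 h2; rewrite !mem_E ee /= => /andP[_ nf].
rewrite (rcoef_supp c_gt0 h2) /=; apply: contra nf => h.
by rewrite addmC addnC; apply: frob_expD h (rcoef_supp c_gt0 h1).
Qed.

Let take_mem m e : e \in take m Es -> e \in E.
Proof. by move=> /mem_take; rewrite mem_Es. Qed.

(** The coefficient of a product at [e] involves the second factor only at [e] itself and at
    exponents of smaller weight, which come earlier in [Es]. *)
Lemma vanishing_take_ideal m : is_ideal (vanishing (take m Es)).
Proof.
split=> [e _|f g hf hg e he|f g hg e he]; first by rewrite rcoef0.
  by rewrite rcoefD hf // hg // addr0.
apply/eqP; apply: contraT => /rcoefM_neq0 [b1 [b2 [n1 [n2 [eb en h1 h2]]]]].
have ee : e = ((b1 + b2)%MM, (n1 + n2)%N) by rewrite -eb -en; case: (e).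
have h2E := not_frob (take_mem he) ee h1 h2.
have := hg (b2, n2); rewrite /= => h2'; case/eqP: h2; apply: h2'.
have [e1|ne1] := boolP ((b1 == 0%MM) && (n1 == 0%N)).
  by move: he; rewrite ee; case/andP: e1 => /eqP -> /eqP ->; rewrite addmC addm0.
apply: (take_down he h2E); rewrite ee /weight /= mdegD.
suff : (0 < mdeg b1)%N by lia.
apply: leq_trans c_gt0 _; apply: rees_exp_gt0 (rcoef_supp c_gt0 h1) _.
by rewrite -negb_and.
Qed.

(** An element [s] outside [M] has a nonzero constant coefficient [a], so the coefficient of s f at
    [e] is that of f times [a], plus terms of smaller weight, which vanish by induction. *)
Lemma vanishing_take_saturated m (hM : prime_ideal M) :
  saturated M (vanishing (take m Es)).
Proof.
move=> s f Ms hsf e he.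
have [l] := ubnP (weight e); elim: l e he => // l IH e he hl.
set a := rcoef s 0 0.
have a0 : a != 0 by apply/eqP => h; apply: Ms; apply/rees_max_rcoef.
have := hsf e he; rewrite -[s](subrK (rees_scalar d c a)) mulrDl rcoefD rcoef_scalarM.
set s' := s - _; suff -> : rcoef (s' * f) e.1 e.2 = 0.
  by rewrite add0r => /eqP; rewrite mulf_eq0 (negbTE a0) => /eqP.
apply/eqP; apply: contraT => /rcoefM_neq0 [b1 [b2 [n1 [n2 [eb en h1 h2]]]]].
have ee : e = ((b1 + b2)%MM, (n1 + n2)%N) by rewrite -eb -en; case: (e).
have h2E := not_frob (take_mem he) ee h1 h2.
have lt_w : (weight (b2, n2) < weight e)%N.
  rewrite ee /weight /= mdegD; suff : (0 < mdeg b1)%N by lia.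
  apply: leq_trans c_gt0 _; apply: rees_exp_gt0 (rcoef_supp c_gt0 h1) _.
  rewrite -negb_and; apply: contra_neqN h1 => /andP[/eqP -> /eqP ->].
  rewrite /s' rcoefD rcoefN -[rees_scalar _ _ _]mulr1 rcoef_scalarM rcoef1 !eqxx.
  by rewrite mulr1 subrr.
case/eqP: h2; apply: (IH (b2, n2)); first exact: (take_down he h2E).
exact: leq_trans lt_w hl.
Qed.

Lemma length_frob_rees (R : realType) p (hM : prime_ideal M) :
  p \in [pchar k] -> p.-nat q ->
  @length_quot (localization hM) R (frob_power (extend (hP := hM) M) q) =
    (size E)%:R%:E.
Proof.
move=> hp pq; apply: length_quot_loc; last exact: frob_chain_bound.
(* Releasing the last exponent admits its monomial, which makes the inclusion strict. *)
exists (fun i => vanishing (take (size E - i) Es)); split.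
- move=> f Mf e; rewrite subn0 -size_Es take_size mem_Es mem_E => /andP[_ he].
  exact: (rees_max_frob hp).
- move=> i _; split; [exact: vanishing_take_ideal | exact: vanishing_take_saturated].
move=> i hi; have hs : (size E - i = (size E - i.+1).+1)%N by lia.
have hlt : (size E - i.+1 < size Es)%N by rewrite size_Es; lia.
pose e0 : 'X_{1..d} * nat := (0%MM, 0%N).
rewrite hs (take_nth e0 hlt); set m := (size E - i.+1)%N; split.
  by move=> f hf e he; apply: hf; rewrite mem_rcons inE he orbT.
have he : nth e0 Es m \in E by rewrite -mem_Es mem_nth.
have hex : rees_exp c (nth e0 Es m).1 (nth e0 Es m).2.
  by move: he; rewrite mem_E => /andP[].
have [f hf] := rees_monomial_ex k c_gt0 hex.
move=> /(_ f) hQ; have /hQ : vanishing (take m Es) f.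
  move=> e het; rewrite hf; case: andP => // -[/eqP e1 /eqP e2].
  have ee : e = nth e0 Es m.
    by case: (e) e1 e2 => /= ? ? -> ->; case: (nth _ _ _).
  move: Es_uniq; rewrite -(cat_take_drop m Es) cat_uniq => /and3P[_ /hasPn h _].
  by move: (h e); rewrite /= het ee (drop_nth e0 hlt) mem_head => /(_ isT).
move=> /(_ (nth e0 Es m)); rewrite mem_rcons mem_head hf !eqxx => /(_ isT) /eqP.
by rewrite oner_eq0.
Qed.

End Chains.
End FrobeniusLength.

(** * Counting exponents *)

Lemma big_nat_mul (T : Type) (idx : T) (op : Monoid.law idx) (m q : nat) F :
  \big[op/idx]_(0 <= x < m * q) F x =
  \big[op/idx]_(0 <= l < m) \big[op/idx]_(0 <= r < q) F (q * l + r)%N.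
Proof.
elim: m => [|m IH]; first by rewrite mul0n !big_geq.
rewrite big_nat_recr //= -IH mulSn addnC (big_cat_nat (n := m * q)) ?leq_addr //=.
congr (op _ _); rewrite -{1}[(m * q)%N]add0n big_addn addKn.
by apply: eq_bigr => i _; rewrite addnC mulnC.
Qed.

(** * Sums over cubes *)

Section CubeSums.
Variable V : zmodType.
Implicit Types (F : nat -> V) (G : nat -> nat -> V).

(** Division with remainder in each coordinate cuts the cube into boxes of side [q]. *)
Lemma sum_cube_mul d (m q : nat) G : (0 < q)%N ->
  \sum_(s <- cube d (m * q)) G (sumn [seq (x %/ q)%N | x <- s]) (sumn s) =
  \sum_(l <- cube d m) \sum_(r <- cube d q) G (sumn l) (q * sumn l + sumn r)%N.
Proof.
move=> q_gt0; elim: d G => [|d IH] G; first by rewrite !big_cube0 muln0.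
rewrite !big_cubeS big_nat_mul; apply: eq_bigr => l _.
under [RHS]eq_bigr do rewrite big_cubeS.
rewrite [RHS]exchange_big /= [LHS]big_nat_cond [RHS]big_nat_cond.
apply: eq_bigr => r /andP[/andP[_ hr] _].
have qlr : ((q * l + r) %/ q = l)%N by rewrite mulnC divnMDl // divn_small // addn0.
rewrite /= qlr (IH (fun a b => G (l + a) (q * l + r + b))%N); apply: eq_bigr => l' _.
by apply: eq_bigr => r' _; congr G; lia.
Qed.

Lemma sum_bin_diag (m n : nat) : (\sum_(0 <= x < n) 'C(x + m, m) = 'C(n + m, m.+1))%N.
Proof.
elim: n => [|n IH]; first by rewrite big_geq // bin_small.
by rewrite big_nat_recr //= IH addSn binS addnC.
Qed.

(** There are C(x + d, d) lists of length d + 1 with sum x. For x < N none of them leaves the cube,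
    and from [N] on [F] vanishes. *)
Lemma sum_cube_sumn d (N : nat) F : (forall x, (N <= x)%N -> F x = 0) ->
  \sum_(s <- cube d.+1 N) F (sumn s) = \sum_(0 <= x < N) F x *+ 'C(x + d, d).
Proof.
elim: d F => [|d IH] F F0.
  rewrite big_cubeS; apply: eq_bigr => x _.
  by rewrite big_cube0 /= !addn0 bin0.
rewrite big_cubeS.
have -> : \sum_(0 <= x < N) \sum_(s <- cube d.+1 N) F (sumn (x :: s)) =
    \sum_(0 <= x < N) \sum_(0 <= y < N) F (x + y)%N *+ 'C(y + d, d).
  apply: eq_bigr => x _; rewrite -(IH (fun y => F (x + y)%N)) // => y hy.
  by rewrite F0 // (leq_trans hy) // leq_addl.
rewrite exchange_big /=.
have eqy y : (0 <= y < N)%N -> \sum_(0 <= x < N) F (x + y)%N *+ 'C(y + d, d) =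
    \sum_(0 <= z < N) (if (y <= z)%N then F z *+ 'C(y + d, d) else 0).
  move=> /andP[_ hy]; rewrite [RHS](big_cat_nat (n := y)) ?(ltnW hy) //=.
  rewrite [X in _ = X + _]big_nat_cond [X in _ = X + _]big1 ?add0r; last first.
    by move=> i /andP[/andP[_ hi] _]; rewrite leqNgt hi.
  rewrite (big_cat_nat (n := N - y)) ?leq_subr //= [X in _ + X]big_nat_cond.
  rewrite [X in _ + X]big1 ?addr0; last first.
    by move=> i /andP[/andP[hi _] _]; rewrite F0 ?mul0rn //; lia.
  rewrite -[X in _ = \sum_(X <= _ < _) _]add0n big_addn; apply: eq_bigr => i _.
  by rewrite leq_addl.
rewrite (eq_big_nat _ _ eqy).
rewrite exchange_big /=; apply: eq_big_nat => z /andP[_ hz].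
rewrite -big_mkcond /= sumrMnr; congr (_ *+ _).
rewrite addnS -addSn -sum_bin_diag big_mkcond /= (big_cat_nat (n := z.+1)) //=.
rewrite [X in (_ + X)%N]big_nat_cond [X in (_ + X)%N]big1 ?addn0; last first.
  by move=> i /andP[/andP[hi _] _]; rewrite leqNgt hi.
by apply: eq_big_nat => i /andP[_ hi]; rewrite -ltnS hi.
Qed.

End CubeSums.

(** The diagonal identity applied twice: raising [n] by one adds a partial sum of the binomials. *)
Lemma sum_bin_weighted (m n : nat) :
  (\sum_(0 <= x < n) (n - x) * 'C(x + m, m) = 'C(n + m.+1, m.+2))%N.
Proof.
elim: n => [|n IH]; first by rewrite big_geq // bin_small.
rewrite addSn binS -IH -addSnnS -sum_bin_diag.
rewrite !big_nat_recr //= subSnn mul1n addnA; congr (_ + _)%N.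
rewrite -big_split /=; apply: eq_big_nat => x /andP[_ hx].
by rewrite subSn ?(ltnW hx) // mulSn addnC.
Qed.

(* A Riemann sum over the multiples of c, compared with the full sums by
   monotonicity of the binomial coefficients. *)
Section SparseSum.
Variables (c m q : nat).
Hypothesis c_gt0 : (0 < c)%N.

Definition sparse_sum := (\sum_(0 <= j < 2 * q) (2 * q - 1 - j) * 'C(c * j + m, m))%N.

Let leq_binl a b : (a <= b)%N -> ('C(a + m, m) <= 'C(b + m, m))%N.
Proof. by move=> h; apply: leq_bin2l; rewrite leq_add2r. Qed.

(** On the block [c j, c j + c) of the full sum, the weight and the binomial are at least c (2 q - 1
    - j) and C(c j + m, m); the c points of the block give the second factor c. *)
Lemma sparse_sum_ub : (c ^ 2 * sparse_sum <= 'C(2 * q * c + m.+1, m.+2))%N.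
Proof.
rewrite -sum_bin_weighted big_nat_mul big_distrr /= !big_nat.
apply: leq_sum => j /andP[_ hj].
apply: leq_trans (_ : \sum_(0 <= i < c) c * (2 * q - 1 - j) * 'C(c * j + m, m)
  <= _)%N.
  by rewrite sum_nat_const_nat subn0; lia.
rewrite !big_nat; apply: leq_sum => i /andP[_ hi].
apply: leq_mul; last by apply: leq_binl; rewrite leq_addr.
have -> : (2 * q * c - (c * j + i) = c * (2 * q - 1 - j) + (c - i))%N.
  rewrite -subnDA mulnBr;
    have : (c * (1 + j) <= c * (2 * q))%N by rewrite leq_mul2l; lia.
  by rewrite mulnDr; lia.
exact: leq_addr.
Qed.

(** Block [j] is bounded by the multiple of c just after it, that is by term [j.+1]; two blocks
    fewer make room for this shift. *)
Lemma sparse_sum_lb : ('C((2 * q - 2) * c + m.+1, m.+2) <= c ^ 2 * sparse_sum)%N.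
Proof.
rewrite -sum_bin_weighted big_nat_mul.
apply: leq_trans (_ : \sum_(0 <= j < 2 * q - 2)
    c ^ 2 * ((2 * q - 1 - j.+1) * 'C(c * j.+1 + m, m)) <= _)%N.
  rewrite !big_nat; apply: leq_sum => j /andP[_ hj].
  apply: leq_trans (_ : \sum_(0 <= i < c) c * (2 * q - 1 - j.+1) * 'C(c * j.+1
    + m, m) <= _)%N.
    rewrite !big_nat; apply: leq_sum => i /andP[_ hi].
    apply: leq_mul; last by apply: leq_binl; rewrite mulnS addnC leq_add2r ltnW.
    by rewrite subnDA (mulnC _ c) -mulnBr; apply: leq_trans (leq_subr _ _) _;
      rewrite leq_mul2l; lia.
  by rewrite sum_nat_const_nat subn0; lia.
rewrite -big_distrr leq_mul2l; apply/orP; right; rewrite /sparse_sum.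
case: (posnP q) => [->|q_gt0]; first by rewrite big_geq.
have [n ->] : exists n, (2 * q = n.+2)%N by exists (2 * q - 2)%N; lia.
have -> : (n.+2 - 2 = n)%N by lia.
rewrite [leqRHS]big_nat_recl // [X in (_ <= _ + X)%N]big_nat_recr //=.
exact: leq_trans (leq_addr _ _) (leq_addl _ _).
Qed.

End SparseSum.

Lemma count_interval (a b N : nat) : (b <= N)%N ->
  (\sum_(0 <= n < N) (a <= n < b) = b - a)%N.
Proof.
move=> hb; elim: N b hb => [|N IH] b hb; first by rewrite big_geq //; lia.
rewrite big_nat_recr //=; move: hb; rewrite leq_eqVlt => /predU1P[->|hb].
  rewrite (eq_big_nat _ _ (F2 := fun n => (a <= n < N)%N : nat));
    last by move=> i; lia.
  by rewrite IH //; case: leqP; lia.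
by rewrite IH //; lia.
Qed.

(** * The list of remaining exponents *)

Section FrobeniusCount.
Variables (d c q : nat) (c_gt0 : (0 < c)%N) (hdc : (d <= c)%N) (q_gt0 : (0 < q)%N).

(** The cut-off 2 c q loses nothing: either the floors sum to less than c and [sumn_small_div]
    applies, or |b| < c (n + q) with n < q; and n <= |b|. *)
Definition frob_basis : seq ('X_{1..d} * nat) :=
  [seq e <- [seq (mnm_of_seq d s, n) | s <- cube d (2 * c * q), n <- iota 0 (2
    * c * q)]
  | rees_exp c e.1 e.2 && ~~ frob_exp c q e.1 e.2].

Lemma frob_basis_uniq : uniq frob_basis.
Proof.
apply/filter_uniq/allpairs_uniq; rewrite ?cube_uniq ?iota_uniq //.
move=> [s n] [t m] /allpairsP [[s' n'] /= [hs _ [-> ->]]].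
move=> /allpairsP [[t' m'] /= [ht _ [-> ->]]] est.
congr pair; last exact: (congr1 snd est).
have {}est : mnm_of_seq d s' = mnm_of_seq d t' := congr1 fst est.
have sz u : u \in cube d (2 * c * q) -> size u = d.
  by rewrite mem_cube => /andP[/eqP].
by rewrite -(seq_of_mnmK (sz _ hs)) est seq_of_mnmK ?sz.
Qed.

Lemma sumn_div (s : seq nat) : (q * sumn [seq (x %/ q)%N | x <- s] <= sumn s)%N.
Proof.
elim: s => [|x s IH] /=; rewrite ?muln0 // mulnDr leq_add // mulnC.
exact: leq_divM.
Qed.

Lemma sumn_lt_div (s : seq nat) :
  (sumn s <= q * sumn [seq (x %/ q)%N | x <- s] + size s * q.-1)%N.
Proof.
elim: s => [|x s IH] //=; rewrite mulnDr mulSn addnACA leq_add //.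
rewrite {1}(divn_eq x q) mulnC leq_add2l -ltnS prednK //.
exact: ltn_pmod.
Qed.

(** The sum is at most q (c - 1) + d (q - 1), which is below 2 c q because d <= c. *)
Lemma sumn_small_div (s : seq nat) : size s = d ->
  (sumn [seq (x %/ q)%N | x <- s] < c)%N -> (sumn s < 2 * c * q)%N.
Proof.
move=> hs hc; apply: leq_ltn_trans (sumn_lt_div s) _; rewrite hs.
apply: leq_ltn_trans (_ : q * c.-1 + c * q.-1 < _)%N.
  by rewrite leq_add // ?leq_mul2r ?leq_mul2l ?hdc ?orbT // -ltnS prednK // hc orbT.
case: (c) c_gt0 => // c' _; case: (q) q_gt0 => // q' _ /=; nia.
Qed.

Lemma frob_exp_seq (s : seq nat) n : size s = d ->
  frob_exp c q (mnm_of_seq d s) n =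
  (c <= sumn [seq (x %/ q)%N | x <- s])%N && ((c * (n + q) <= sumn s) || (q <= n))%N.
Proof.
move=> hs; rewrite /frob_exp mdeg_mnm_of_seq //; congr ((_ <= _)%N && _).
rewrite sumnE big_map (big_nth 0%N) hs big_mkord.
by apply: eq_bigr => i _; rewrite mnmE.
Qed.

Lemma mem_frob_basis e :
  (e \in frob_basis) = rees_exp c e.1 e.2 && ~~ frob_exp c q e.1 e.2.
Proof.
case: e => b n; rewrite mem_filter andb_idr //= => /andP[/andP[dvd_b le_nb] nf].
have sb : size (b : seq nat) = d by rewrite size_tuple.
have lt_b : (mdeg b < 2 * c * q)%N /\ (n < 2 * c * q)%N.
  suff lt_b : (mdeg b < 2 * c * q)%N.
    by split=> //; apply: leq_ltn_trans lt_b; apply: leq_trans le_nb;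
      rewrite leq_pmull.
  rewrite -(mnm_of_seqK b) frob_exp_seq // in nf; rewrite /mdeg -sumnE.
  move: nf; rewrite negb_and -ltnNge => /orP[|]; first exact: sumn_small_div.
  rewrite negb_or -!ltnNge => /andP[hlt hn]; apply: leq_trans hlt _.
  by rewrite mulnAC mulnC leq_mul2r; lia.
apply/allpairsP; exists (b : seq nat, n); rewrite /= mnm_of_seqK mem_iota /=.
by case: lt_b => h1 ->; rewrite mnm_cube.
Qed.

Let weight l X := if (c %| X)%N then
  (if (l < c)%N then (X %/ c).+1 else (2 * q - 1 - X %/ c)%N) else 0%N.

Lemma size_frob_basis : size frob_basis =
  (\sum_(s <- cube d (2 * c * q)) weight (sumn [seq (x %/ q) | x <- s]) (sumn s))%N.
Proof.
rewrite -sum1_size big_filter big_mkcond big_allpairs_dep /= big_seq [RHS]big_seq.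
apply: eq_bigr => s; rewrite mem_cube => /andP[/eqP hs _].
set l := sumn (map _ _); have hl := sumn_div s; rewrite -/l in hl.
under eq_bigr do rewrite frob_exp_seq // /rees_exp mdeg_mnm_of_seq // -/l.
rewrite /weight; case: (boolP (c %| sumn s)%N) => [/dvdnP [j hj]|_];
  last by rewrite big1.
rewrite mulnC in hj; rewrite hj mulKn //.
have hle n m : (c * n <= c * m = (n <= m))%N by rewrite leq_pmul2l.
under eq_bigr do rewrite !hle /=.
case: ltnP => hlc /=.
  have := sumn_small_div hs hlc; rewrite hj => hj2.
  rewrite -[in RHS](subn0 j.+1) -(@count_interval 0 j.+1 (2 * c * q)); last first.
    by apply: leq_ltn_trans hj2; rewrite leq_pmull.
  rewrite /index_iota subn0; apply: eq_bigr => n _; rewrite ltnS andbT.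
  by case: (n <= j)%N.
have le_qj : (q <= j)%N.
  by rewrite -(leq_pmul2l c_gt0) -hj mulnC; apply: leq_trans hl;
    rewrite leq_mul2l hlc orbT.
(* Here [n] runs through j - q < n < q; both sides are 0 once 2 q <= j. *)
have -> : (2 * q - 1 - j = q - (j - q).+1)%N by lia.
rewrite -(@count_interval _ q (2 * c * q)) /index_iota ?subn0; last first.
  by rewrite leq_pmull // muln_gt0.
apply: eq_bigr => n _; rewrite negb_or -!ltnNge.
have -> : ((n <= j) && ((j < n + q) && (n < q)) = ((j - q < n) && (n < q)))%N by lia.
by case: (_ && _).
Qed.

End FrobeniusCount.

Section CountDecomposition.
Variables (R : realType) (m c q : nat).
Hypotheses (c_gt0 : (0 < c)%N) (hmc : (m < c)%N) (q_gt0 : (0 < q)%N).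

(* The difference of j + 1 and 2 q - 1 - j, for y = c j *)
Definition residue_term (y : nat) : R :=
  if (c %| y)%N then (2 * (y %/ c).+1)%:R - (2 * q)%:R else 0.

Definition box_sum (x : nat) : R :=
  \sum_(r <- cube m.+1 q) residue_term (q * x + sumn r).

(** A box enters only through |l| = x, a value shared by C(x + m, m) boxes; here d = m + 1. *)
Lemma size_frob_basis_split : (size (frob_basis m.+1 c q))%:R =
  (sparse_sum c m q)%:R + \sum_(0 <= x < c) box_sum x *+ 'C(x + m, m) :> R.
Proof.
rewrite size_frob_basis //.
pose a (X : nat) : R := if (c %| X)%N then (2 * q - 1 - X %/ c)%N%:R else 0.
pose b (l X : nat) : R := if (l < c)%N then residue_term X else 0.
rewrite natr_sum big_seq.
rewrite (eq_bigr (fun s => a (sumn s) + b (sumn [seq (x %/ q)%N | x <- s])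
  (sumn s))); last first.
  move=> s; rewrite mem_cube => /andP[/eqP hs _]; rewrite /a /b /residue_term.
  case: ifP => [dvd_s|_]; last by rewrite add0r if_same.
  case: ifP => hl; last by rewrite addr0.
  (* Below 2 q the natural subtraction is exact, and the two counts differ by [residue_term]. *)
  have lt_s : (sumn s %/ c < 2 * q)%N.
    by rewrite ltn_divLR // mulnAC; apply: (sumn_small_div (d := m.+1)) hl.
  have le1 : (sumn s %/ c <= 2 * q - 1)%N by lia.
  rewrite natrB // natrB; last by lia.
  by rewrite natrM -natr1 natrM; lra.
rewrite -big_seq big_split; congr (_ + _).
  rewrite mulnAC (sum_cube_sumn _ (F := a)); last first.
    move=> x hx; rewrite /a; case: ifP => // _.
    by have : (2 * q <= x %/ c)%N by [rewrite leq_divRL]; move=> ?;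
      rewrite (_ : _ - _ = 0)%N //; lia.
  rewrite big_nat_mul /sparse_sum natr_sum; apply: eq_bigr => j _.
  rewrite big_ltn // addn0 big_nat_cond big1; last first.
    move=> i /andP[/andP[i1 i2] _]; rewrite /a dvdn_addr ?dvdn_mulr //.
    by rewrite gtnNdvd // mul0rn.
  by rewrite /= addr0 /a dvdn_mulr // mulKn // natrM mulr_natr.
rewrite (sum_cube_mul _ _ b) //.
pose t x := if (x < c)%N then box_sum x else 0.
rewrite (eq_bigr (fun s => t (sumn s))); last first.
  by move=> s _; rewrite /t /b; case: ifP => // _; rewrite big1.
rewrite sum_cube_sumn; last first.
  by move=> x hx; rewrite /t ltnNge (leq_trans _ hx) // leq_pmull.
rewrite (big_cat_nat (n := c)) ?leq_pmull //= [X in _ + X]big_nat_cond.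
rewrite [X in _ + X]big1 ?addr0; last first.
  by move=> x /andP[/andP[hx _] _]; rewrite /t ltnNge hx mul0rn.
by apply: eq_big_nat => x /andP[_ hx]; rewrite /t hx.
Qed.

End CountDecomposition.

(** * Asymptotics *)

Section Window.
Variables (R : realType) (q : nat).
Implicit Types (F : nat -> R).

Definition cube_sum n F : R := \sum_(r <- cube n q) F (sumn r).

Lemma cube_sumS n F :
  cube_sum n.+1 F = \sum_(0 <= x < q) cube_sum n (fun y => F (x + y)%N).
Proof. exact: big_cubeS. Qed.

Lemma sumn_cube_le n r : r \in cube n q -> (sumn r <= n * q)%N.
Proof.
elim: n r => [|n IH] [|x r]; rewrite mem_cube //= => /andP[hs /andP[hx hr]].
by rewrite mulSn; apply: leq_add; [exact: ltnW | apply: IH;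
  rewrite mem_cube -eqSS hs].
Qed.

Lemma cube_sum_le n F K : (forall y, (y <= n * q)%N -> `|F y| <= K) ->
  `|cube_sum n F| <= K * (q ^ n)%:R.
Proof.
move=> hF; apply: le_trans (ler_norm_sum _ _ _) _.
rewrite -size_cube -sum1_size natr_sum mulr_sumr big_seq [leRHS]big_seq.
by apply: ler_sum => r /sumn_cube_le hr; rewrite mulr1 hF.
Qed.

(** Translation by one telescopes in the first coordinate; two faces of q^n points remain, each
    contributing at most K q^n. *)
Lemma cube_sum_step n F K : (forall y, (y <= n.+1 * q)%N -> `|F y| <= K) ->
  `|cube_sum n.+1 (fun y => F y.+1) - cube_sum n.+1 F| <= 2 * K * (q ^ n)%:R.
Proof.
move=> hF; rewrite !cube_sumS -sumrB.
have -> : \sum_(0 <= x < q) (cube_sum n (fun y => F (x + y).+1) -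
      cube_sum n (fun y => F (x + y)%N)) =
    cube_sum n (fun y => F (q + y)%N) - cube_sum n (fun y => F (0 + y)%N).
  by rewrite -(telescope_sumr (fun x => cube_sum n (fun y => F (x + y)%N))).
apply: le_trans (ler_normB _ _) _; rewrite mulrDl mul1r mulrDl.
apply: lerD; apply: cube_sum_le => y hy; apply: hF; rewrite mulSn.
  by rewrite leq_add2l.
by rewrite add0n (leq_trans hy) // leq_addl.
Qed.

Lemma cube_sum_shift n F K i : (forall y, (y <= n.+1 * q + i)%N -> `|F y| <= K) ->
  `|cube_sum n.+1 (fun y => F (y + i)%N) - cube_sum n.+1 F| <=
    i%:R * (2 * K * (q ^ n)%:R).
Proof.
elim: i => [|i IH] hF.
  rewrite mul0r (_ : cube_sum _ _ = cube_sum n.+1 F) ?subrr ?normr0 //.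
  by apply: eq_bigr => r _; rewrite addn0.
rewrite -natr1 mulrDl mul1r.
apply: le_trans (ler_distD (cube_sum n.+1 (fun y => F (y + i)%N)) _ _) _.
rewrite addrC lerD //.
  by apply: IH => y hy; apply: hF; rewrite addnS ltnW.
have := @cube_sum_step n (fun y => F (y + i)%N) K.
under [X in cube_sum _ X - _]eq_fun do rewrite addSnnS; apply.
by move=> y hy; apply: hF; rewrite addnS -addSn leq_add // ltnW.
Qed.

(** A coordinate has mean (q - 1) / 2, so 2 y has mean n (q - 1) over the cube. *)
Lemma cube_sum_affine n (a b : R) :
  cube_sum n (fun y => a + 2 * y%:R * b) =
  (q ^ n)%:R * (a + n%:R * (q%:R - 1) * b).
Proof.
elim: n a => [|n IH] a.
  by rewrite /cube_sum big_cube0 expn0 !mulr0 !mul0r mul1r.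
rewrite cube_sumS.
have eqx x : cube_sum n (fun y => a + 2 * (x + y)%:R * b) =
    (q ^ n)%:R * (a + n%:R * (q%:R - 1) * b) + (q ^ n)%:R * (2 * b) * x%:R.
  rewrite -[RHS](_ : (q ^ n)%:R * ((a + 2 * x%:R * b) + n%:R * (q%:R - 1) * b)
    = _); last by ring.
  by rewrite -IH; apply: eq_bigr => r _; rewrite natrD; ring.
under eq_bigr do rewrite eqx.
rewrite big_split /= sumr_const_nat subn0 -mulr_sumr -natr_sum.
have -> : (\sum_(0 <= i < q) i)%N%:R = q%:R * (q%:R - 1) / 2 :> R.
  elim: q => [|q' IHq]; first by rewrite big_geq // !mul0r.
  by rewrite big_nat_recr //= natrD IHq -natr1; field.
by rewrite expnS natrM -mulr_natr -natr1; field.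
Qed.

End Window.

(** Exactly one of c consecutive integers is a multiple of c. *)
Lemma sum_window (V : zmodType) (c y : nat) (F : nat -> V) : (0 < c)%N ->
  (forall z, ~~ (c %| z)%N -> F z = 0) ->
  exists2 i, (i < c)%N /\ (c %| y + i)%N & \sum_(0 <= j < c) F (y + j)%N = F (y
    + i)%N.
Proof.
move=> c_gt0 hF.
have [i hi dvd_i] : exists2 i, (i < c)%N & (c %| y + i)%N.
  exists ((c - y %% c) %% c)%N; first exact: ltn_pmod.
  rewrite /dvdn modnDmr -modnDml subnKC ?modnn //.
  exact/ltnW/ltn_pmod.
exists i => //; rewrite (bigD1_seq i) ?iota_uniq ?mem_index_iota //= big_seq_cond.
rewrite big1 ?addr0 // => j; rewrite mem_index_iota => /andP[/andP[_ hj] ne].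
apply: hF; apply: contra ne => dvd_j.
have : (y + j == y + i %[mod c])%N by move: dvd_j dvd_i;
  rewrite /dvdn => /eqP -> /eqP ->.
by rewrite eqn_modDl !modn_small.
Qed.

(** * The sum over one box *)

Section BoxSum.
Variables (R : realType) (m c q x : nat).
Hypotheses (c_gt0 : (0 < c)%N) (hmc : (m < c)%N) (q_gt0 : (0 < q)%N) (hx : (x < c)%N).

Local Notation F := (fun y => residue_term R c q (q * x + y)).

(** The range 3 c q covers the corner q x, the coordinate sum and a shift, each at most c q. *)
Lemma residue_term_le y : (y <= 3 * c * q)%N ->
  `|residue_term R c q y| <= (10 * c * q)%:R.
Proof.
move=> hy; rewrite /residue_term; case: ifP => _; last by rewrite normr0 ler0n.
have hyc : (y %/ c <= y)%N by apply: leq_div.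
have hcq : (1 <= c * q)%N by rewrite muln_gt0 c_gt0.
have hqc : (q <= c * q)%N by rewrite leq_pmull.
apply: le_trans (ler_normB _ _) _; rewrite !normr_nat -natrD ler_nat.
lia.
Qed.

(** The only multiple y + i of c contributes 2 (y + i) + 2 c - 2 q c after multiplication by c, and
    2 i + 2 c <= 4 c. *)
Lemma window_residue y :
  `|c%:R * (\sum_(0 <= i < c) residue_term R c q (y + i)) -
    (2 * y%:R - 2 * q%:R * c%:R)| <= 4 * c%:R.
Proof.
have [|i [hi dvd_i] ->] := @sum_window R c y (residue_term R c q) c_gt0.
  by move=> z hz; rewrite /residue_term (negbTE hz).
rewrite /residue_term dvd_i.
have e : c%:R * (2 * ((y + i) %/ c).+1)%:R = 2 * (y%:R + i%:R) + 2 * c%:R :> R.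
  have ediv : (c * ((y + i) %/ c) = y + i)%N by rewrite mulnC divnK.
  rewrite -natrM (_ : (c * _ = 2 * (y + i) + 2 * c)%N).
    by rewrite natrD !natrM natrD.
  by rewrite mulnCA mulnS ediv; lia.
rewrite mulrBr e natrM.
have -> : 2 * (y%:R + i%:R) + 2 * c%:R - c%:R * (2 * q%:R) -
    (2 * y%:R - 2 * q%:R * c%:R) = 2 * i%:R + 2 * c%:R :> R by ring.
have : i%:R <= c%:R :> R by rewrite ler_nat ltnW.
have : 0 <= i%:R :> R by rewrite ler0n.
have : 0 <= c%:R :> R by rewrite ler0n.
by move=> *; rewrite ger0_norm; lra.
Qed.

(** [A] sums c translates and is close to c times the box sum, while c A is close to the affine sum
    [B]. In the error, 20 c^4 comes from the translations, 4 c from the windows, and c from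
    replacing q - 1 by q in [B]. *)
Lemma box_sum_estimate :
  `|c%:R ^+ 2 * box_sum R m c q x -
    (2 * x%:R - 2 * c%:R + m.+1%:R) * q%:R ^+ m.+2| <=
  (20 * c%:R ^+ 4 + 5 * c%:R) * q%:R ^+ m.+1.
Proof.
have hbox : box_sum R m c q x = cube_sum q m.+1 F by [].
have hK i : (i < c)%N -> `|cube_sum q m.+1 (fun y => F (y + i)%N) - cube_sum q
  m.+1 F| <=
    c%:R * (2 * (10 * c * q)%:R * (q ^ m)%:R).
  move=> hi; apply: le_trans (cube_sum_shift (K := (10 * c * q)%:R) _) _.
    move=> y hy; apply: residue_term_le.
    have : (m.+1 * q <= c * q)%N by rewrite leq_mul2r hmc orbT.
    have : (q * x <= c * q)%N by rewrite mulnC leq_mul2r (ltnW hx) orbT.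
    have : (c <= c * q)%N by rewrite leq_pmulr.
    by move: hy hi; rewrite -(mulnA 3); move: (c * q)%N (m.+1 * q)%N (q * x)%N; lia.
  by rewrite ler_wpM2r ?ler_nat ?(ltnW hi) // -!natrM ler0n.
pose A := \sum_(0 <= i < c) cube_sum q m.+1 (fun y => F (y + i)%N).
have hA : `|A - c%:R * cube_sum q m.+1 F| <= c%:R * (c%:R * (2 * (10 * c *
  q)%:R * (q ^ m)%:R)).
  have -> : c%:R * cube_sum q m.+1 F = \sum_(0 <= i < c) cube_sum q m.+1 F.
    by rewrite sumr_const_nat subn0 mulr_natl.
  rewrite /A -sumrB; apply: le_trans (ler_norm_sum _ _ _) _.
  have -> : forall t : R, c%:R * t = \sum_(0 <= i < c) t.
    by move=> t; rewrite sumr_const_nat subn0 mulr_natl.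
  by rewrite big_nat [leRHS]big_nat; apply: ler_sum => i /andP[_ /hK].
pose B : R := cube_sum q m.+1 (fun y => (2 * q%:R * x%:R - 2 * q%:R * c%:R) + 2
  * y%:R * 1).
have hB : `|c%:R * A - B| <= 4 * c%:R * (q ^ m.+1)%:R.
  have -> : c%:R * A - B = cube_sum q m.+1 (fun y =>
     c%:R * (\sum_(0 <= i < c) residue_term R c q (q * x + y + i)) -
    (2 * (q * x + y)%:R - 2 * q%:R * c%:R)).
    rewrite /A /B /cube_sum exchange_big /= mulr_sumr -sumrB; apply: eq_bigr => r _.
    rewrite natrD natrM; congr (_ - _); last by ring.
    by congr (_ * _); apply: eq_bigr => i _; rewrite addnA.
  by apply: cube_sum_le => y _; apply: window_residue.
have eB : B = q%:R ^+ m.+1 * (2 * q%:R * x%:R - 2 * q%:R * c%:R + m.+1%:R *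
  (q%:R - 1)).
  by rewrite /B cube_sum_affine natrX mulr1.
have {}hA : `|c%:R * (A - c%:R * cube_sum q m.+1 F)| <= 20 * c%:R ^+ 4 * q%:R ^+ m.+1.
  rewrite normrM normr_nat; apply: le_trans (ler_wpM2l (ler0n _ _) hA) _.
  by rewrite !natrM natrX (exprS _ m) le_eqVlt; apply/orP; left; apply/eqP; ring.
rewrite natrX in hB; rewrite hbox.
set T := cube_sum q m.+1 F in hA *.
set Q := q%:R ^+ m.+1 in hA hB eB *.
have -> : c%:R ^+ 2 * T - (2 * x%:R - 2 * c%:R + m.+1%:R) * q%:R ^+ m.+2 =
   (c%:R * A - B) - c%:R * (A - c%:R * T) - m.+1%:R * Q.
  by rewrite eB (exprS _ m.+1) -/Q; ring.
have Q0 : 0 <= Q by rewrite exprn_ge0.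
apply: le_trans (ler_normB _ _) _; rewrite mulrDl.
have hm : `|m.+1%:R * Q| <= c%:R * Q.
  by rewrite ger0_norm ?mulr_ge0 // ler_wpM2r // ler_nat.
apply: le_trans (lerD (ler_normB _ _) hm) _.
by lra.
Qed.

End BoxSum.

(** * Leading coefficients *)

Section Asymptotics.
Variable R : realType.
Implicit Types (F G : nat -> R) (a b K : R) (n : nat).

(** The limit runs over all [q]; powers of p are singled out at the very end. *)
Definition asymp F a n := (fun q : nat => F q / q%:R ^+ n) @ \oo --> a.

Lemma asymp_eq F G a n : (forall q, (0 < q)%N -> F q = G q) ->
  asymp G a n -> asymp F a n.
Proof.
move=> eFG; rewrite /asymp => hG; apply: cvg_trans hG; apply: near_eq_cvg.
by near=> q; rewrite eFG //; near: q; exact: nbhs_infty_gt.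
Unshelve. all: by end_near. Qed.

Lemma cvg_inv_nat : (fun q : nat => (q%:R : R)^-1) @ \oo --> (0 : R).
Proof.
apply/gtr0_cvgV0; last exact: cvgr_idn.
by near=> q; rewrite ltr0n; near: q; exact: nbhs_infty_gt.
Unshelve. all: by end_near. Qed.

Lemma asymp_const a : asymp (fun=> a) a 0.
Proof.
rewrite /asymp; under eq_fun do rewrite expr0 divr1.
exact: cvg_cst.
Qed.

Lemma asymp_linear a b : asymp (fun q => a * q%:R + b) a 1.
Proof.
rewrite /asymp.
have : (fun q : nat => a + b * (q%:R : R)^-1) @ \oo --> a + b * 0.
  by apply: cvgD; [exact: cvg_cst | apply: cvgM;
    [exact: cvg_cst | exact: cvg_inv_nat]].
rewrite mulr0 addr0 => h; apply: cvg_trans h; apply: near_eq_cvg.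
near=> q; rewrite expr1 mulrDl mulfK // pnatr_eq0 -lt0n.
by near: q; exact: nbhs_infty_gt.
Unshelve. all: by end_near. Qed.

Lemma asympM F G a b n n' : asymp F a n -> asymp G b n' ->
  asymp (fun q => F q * G q) (a * b) (n + n').
Proof.
move=> hF hG; rewrite /asymp; under eq_fun do rewrite exprD invfM mulrACA.
exact: cvgM.
Qed.

Lemma asympD F G a b n : asymp F a n -> asymp G b n ->
  asymp (fun q => F q + G q) (a + b) n.
Proof.
move=> hF hG; rewrite /asymp; under eq_fun do rewrite mulrDl.
exact: cvgD.
Qed.

Lemma asympZ F a b n : asymp F a n -> asymp (fun q => b * F q) (b * a) n.
Proof. by move=> hF; exact: (asympM (@asymp_const b) hF). Qed.

Lemma asymp_sum (r : seq nat) (F : nat -> nat -> R) (a : nat -> R) n :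
  (forall i, i \in r -> asymp (F i) (a i) n) ->
  asymp (fun q => \sum_(i <- r) F i q) (\sum_(i <- r) a i) n.
Proof.
elim: r => [|i r IH] hF.
  rewrite big_nil; apply: (@asymp_eq _ (fun=> 0 * 1)) => [q _|].
    by rewrite big_nil mul0r.
  rewrite /asymp; under eq_fun do rewrite !mul0r.
  exact: cvg_cst.
rewrite big_cons; apply: (@asymp_eq _ (fun q => F i q + \sum_(j <- r) F j q)).
  by move=> q _; rewrite big_cons.
apply: asympD; first by apply: hF; rewrite mem_head.
by apply: IH => j hj; apply: hF; rewrite inE hj orbT.
Qed.

Lemma asymp_prod_linear n a (b : nat -> R) :
  asymp (fun q => \prod_(i < n) (a * q%:R + b i)) (a ^+ n) n.
Proof.
elim: n => [|n IH].
  apply: (@asymp_eq _ (fun=> 1)) => [q _|]; first by rewrite big_ord0.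
  exact: asymp_const.
rewrite exprSr; apply: (@asymp_eq _ (fun q => (\prod_(i < n) (a * q%:R + b i))
  * (a * q%:R + b n))).
  by move=> q _; rewrite big_ord_recr.
by rewrite -addn1; apply: asympM; [exact: IH | exact: asymp_linear].
Qed.

Lemma asymp_squeeze F G H a n : (forall q, (0 < q)%N -> F q <= G q <= H q) ->
  asymp F a n -> asymp H a n -> asymp G a n.
Proof.
move=> hFGH; apply: squeeze_cvgr; near=> q.
have q0 : (0 < q)%N by near: q; exact: nbhs_infty_gt.
by case/andP: (hFGH q q0) => hF hH; rewrite !ler_wpM2r ?invr_ge0 ?exprn_ge0.
Unshelve. all: by end_near. Qed.

Lemma asymp_error F a K n :
  (forall q, (0 < q)%N -> `|F q - a * q%:R ^+ n.+1| <= K * q%:R ^+ n) ->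
  asymp F a n.+1.
Proof.
have hlin b : asymp (fun q => (a * q%:R + b) * q%:R ^+ n) a n.+1.
  rewrite -[a in asymp _ a]mulr1 -add1n; apply: asympM; first exact: asymp_linear.
  have := @asymp_prod_linear n 1 (fun=> 0); rewrite expr1n; apply: asymp_eq => q _.
  by rewrite prodr_const card_ord mul1r addr0.
move=> hF; apply: (asymp_squeeze _ (hlin (- K)) (hlin K)) => q q0.
by have := hF q q0; rewrite ler_norml exprS; lra.
Qed.

(** Up to (n + 1)!, the binomial is a product of n + 1 linear factors in q of slope [a]. *)
Lemma asymp_bin (f : nat -> nat) a (b : R) n :
  (forall q, (0 < q)%N -> (f q)%:R = a * q%:R + b) ->
  asymp (fun q => 'C(f q + n, n.+1)%:R) (a ^+ n.+1 / n.+1`!%:R) n.+1.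
Proof.
move=> hf; rewrite mulrC.
apply: (@asymp_eq _ (fun q => n.+1`!%:R^-1 * \prod_(i < n.+1) (a * q%:R + (b +
  n%:R - i%:R)))).
  move=> q q0; apply: (mulfI (_ : n.+1`!%:R != 0 :> R)).
    by rewrite pnatr_eq0 -lt0n fact_gt0.
  rewrite mulVKf ?pnatr_eq0 -?lt0n ?fact_gt0 // mulrC -natrM bin_ffact ffact_prod.
  rewrite natr_prod; apply: eq_bigr => i _; rewrite natrB; last first.
    by rewrite (leq_trans _ (leq_addl _ _)) // -ltnS.
  by rewrite natrD hf //; ring.
apply: asympZ; exact: (@asymp_prod_linear n.+1 a (fun i => b + n%:R - i%:R)).
Qed.

Lemma sparse_sum_asymp c m : (0 < c)%N ->
  asymp (fun q => (sparse_sum c m q)%:R) ((2 * c%:R) ^+ m.+2 / (m.+2)`!%:R /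
    c%:R ^+ 2) m.+2.
Proof.
move=> c0; have cR : c%:R != 0 :> R by rewrite pnatr_eq0 -lt0n.
rewrite mulrC; apply: (@asymp_eq _ (fun q => (c%:R ^+ 2)^-1 * (c ^ 2 *
  sparse_sum c m q)%:R)).
  by move=> q _; rewrite natrM natrX mulKf // expf_neq0.
apply: asympZ; apply: (@asymp_squeeze (fun q => 'C((2 * q - 2) * c + m.+1, m.+2)%:R) _
   (fun q => 'C(2 * q * c + m.+1, m.+2)%:R)).
- move=> q _; rewrite !ler_nat; apply/andP.
  by split; [exact: sparse_sum_lb | exact: sparse_sum_ub].
- apply: (asymp_bin (b := - 2 * c%:R)) => q q0.
  by rewrite natrM natrB ?leq_pmulr // natrM; ring.
- apply: (asymp_bin (b := 0)) => q _.
  by rewrite !natrM; ring.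
Qed.

Lemma box_sum_asymp c m x : (0 < c)%N -> (m < c)%N -> (x < c)%N ->
  asymp (fun q => box_sum R m c q x)
    ((2 * x%:R - 2 * c%:R + m.+1%:R) / c%:R ^+ 2) m.+2.
Proof.
move=> c0 hmc hx; have cR : c%:R ^+ 2 != 0 :> R by rewrite expf_neq0 //
  pnatr_eq0 -lt0n.
rewrite mulrC; apply: (@asymp_eq _ (fun q => (c%:R ^+ 2)^-1 * (c%:R ^+ 2 *
  box_sum R m c q x))).
  by move=> q _; rewrite mulKf.
apply: asympZ; apply: asymp_error => q q0.
exact: box_sum_estimate.
Qed.

(** The last factor is C(n + m, m + 1), the total of the weights C(x + m, m), and (m + 1) (n - 1) /
    (m + 2) is the mean of x for them. *)
Lemma sum_bin_affine m n (t : R) :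
  \sum_(0 <= x < n) (2 * x%:R + t) *+ 'C(x + m, m) =
  ((2 * m.+1%:R * (n%:R - 1)) / m.+2%:R + t) * (\prod_(0 <= i < m.+1) (n +
    i)%:R / m.+1`!%:R).
Proof.
have binE x i : 'C(x + i, i.+1)%:R = \prod_(0 <= j < i.+1) (x + j)%:R /
  i.+1`!%:R :> R.
  elim: i => [|i IH]; first by rewrite big_nat1 !addn0 bin1 divr1.
  have : (i.+2)%:R * 'C(x + i.+1, i.+2)%:R = (x + i.+1)%:R * 'C(x + i, i.+1)%:R :> R.
    by rewrite -!natrM addnS -mul_bin_diag.
  have u0 : i.+2%:R != 0 :> R by rewrite pnatr_eq0.
  rewrite IH => h; apply: (mulfI u0);
    rewrite h [in RHS]big_nat_recr //= (factS i.+1) natrM.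
  have aux (u w y z : R) : u != 0 -> z * (y / w) = u * (y * z / (u * w)).
    by move=> hu; rewrite invfM (mulrCA (y * z)) mulVKf // mulrA (mulrC z).
  exact: aux.
rewrite -binE; elim: n => [|n IH].
  by rewrite big_geq // bin_small // mulr0.
rewrite big_nat_recr //= IH.
have h : m.+1%:R * 'C(n + m, m.+1)%:R = n%:R * 'C(n + m, m)%:R :> R.
  by rewrite -!natrM mul_bin_left addnK.
have m0 : m.+1%:R != 0 :> R by rewrite pnatr_eq0.
have m2 : m.+2%:R != 0 :> R by rewrite pnatr_eq0.
rewrite addSn binS natrD -(mulr_natr _ 'C(n + m, m)).
have -> : 'C(n + m, m.+1)%:R = n%:R * 'C(n + m, m)%:R / m.+1%:R :> R.
  by rewrite -h mulrC mulKf.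
have aux (u v w : R) : u != 0 -> u + 1 != 0 ->
    (2 * u * (v - 1) / (u + 1) + t) * (v * w / u) + (2 * v + t) * w =
    (2 * u * (v + 1 - 1) / (u + 1) + t) * (v * w / u + w).
  by move=> u0 u1; field; rewrite u0 u1.
by have := aux m.+1%:R n%:R 'C(n + m, m)%:R m0; rewrite !natr1 => /(_ m2).
Qed.

Lemma frob_basis_asymp c m : (m < c)%N ->
  asymp (fun q => (size (frob_basis m.+1 c q))%:R)
    (2 ^+ m.+2 * c%:R ^+ m / (m.+2)`!%:R
     - (2 * c%:R - m.+1%:R * (m.+1%:R - 1)) / (c%:R * (m.+2)`!%:R)
       * \prod_(1 <= i < m.+1) (c + i)%:R) m.+2.
Proof.
move=> hmc; have c0 := leq_ltn_trans (leq0n m) hmc.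
apply: (asymp_eq (fun q q0 => size_frob_basis_split R c0 hmc q0)).
have cR : c%:R != 0 :> R by rewrite pnatr_eq0 -lt0n.
set v := (X in asymp _ X).
have -> : v = (2 * c%:R) ^+ m.+2 / (m.+2)`!%:R / c%:R ^+ 2 +
    \sum_(0 <= x < c) 'C(x + m, m)%:R * ((2 * x%:R - 2 * c%:R + m.+1%:R) / c%:R ^+ 2).
  under eq_bigr do rewrite mulrA [_%:R * _]mulr_natl -addrA.
  (* With n = c the affine factor is 2 d (c - 1) / (d + 1) - 2 c + d = - (2 c - d (d - 1)) / (d +
     1), and the factor i = 0 of the product cancels one c of c^2. *)
  rewrite -mulr_suml sum_bin_affine big_ltn // addn0 /v factS natrM.
  have m2 : m.+2%:R != 0 :> R by rewrite pnatr_eq0.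
  have mf : m.+1`!%:R != 0 :> R by rewrite pnatr_eq0 -lt0n fact_gt0.
  rewrite exprMn (exprD _ 2 m : c%:R ^+ m.+2 = _).
  have aux (u C T E F P : R) : u + 1 != 0 -> C != 0 -> F != 0 ->
      T * E / ((u + 1) * F) - (2 * C - u * (u - 1)) / (C * ((u + 1) * F)) * P =
      T * (C ^+ 2 * E) / ((u + 1) * F) / C ^+ 2 +
      ((2 * u * (C - 1)) / (u + 1) + (- (2 * C) + u)) * (C * P / F) / C ^+ 2.
    by move=> u1 C0 F0; field; rewrite u1 C0 F0.
  have := aux m.+1%:R c%:R (2 ^+ m.+2) (c%:R ^+ m) (m.+1`!)%:R (\prod_(1 <= i <
    m.+1) (c + i)%:R).
  by rewrite natr1 => /(_ m2 cR mf).
apply: (@asympD (fun q => (sparse_sum c m q)%:R)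
  (fun q => \sum_(0 <= x < c) box_sum R m c q x *+ 'C(x + m, m))).
  exact: sparse_sum_asymp.
apply: asymp_sum => x; rewrite mem_index_iota => /andP[_ hx].
apply: (@asymp_eq _ (fun q => 'C(x + m, m)%:R * box_sum R m c q x)).
  by move=> q _; rewrite mulr_natl.
by apply: asympZ; apply: box_sum_asymp.
Qed.

End Asymptotics.

Theorem theorem5p2 (R : realType) (k : fieldType) (p : nat)
    (hp : p \in [pchar k]) (c d : nat) (c_gt0 : (0 < c)%N)
    (hd : (2 <= d)%N) (hdc : (d <= c)%N) :
  is_eHK (veronese_rees_loc k d c_gt0) p
    (2 ^+ d.+1 * c%:R ^+ d.-1 / (d.+1)`!%:R
     - (2 * c%:R - d%:R * (d%:R - 1)) / (c%:R * (d.+1)`!%:R)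
       * \prod_(1 <= i < d) (c + i)%:R : R).
Proof.
case: d hd hdc => [//|m] hd hdc.
have p_prime := pcharf_prime hp.
set hM := rees_max_prime (veronese_max_prime k m.+1 c_gt0).
exists (extend (hP := hM) (@rees_max _ _)), m.+2; split.
- exact: loc_is_local.
- apply: krull_dim_loc; first exact: rees_prime_chain.
  by move=> n Q; apply: rees_prime_chain_bound.
have lenE e : length_quot R (frob_power (extend (hP := hM) (@rees_max _ _)) (p ^ e)) =
    (size (frob_basis m.+1 c (p ^ e)))%:R%:E.
  have q_gt0 : (0 < p ^ e)%N by rewrite expn_gt0 prime_gt0.
  apply: (length_frob_rees c_gt0 q_gt0 _ _ R hM hp).
  - exact: frob_basis_uniq.
  - exact: mem_frob_basis.
  - by rewrite pnatX pnat_id.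
under eq_fun do rewrite lenE -EFinM.
apply: cvg_EFin; first by near=> e.
(* The limit over all [q] is composed with q = p^e. *)
have hpe : (fun e => p ^ e)%N @ \oo --> \oo.
  apply/cvgnyPge => N; near=> e; apply: leq_trans (ltnW (ltn_expl e (prime_gt1 p_prime))).
  by near: e; exact: nbhs_infty_ge.
exact: (cvg_comp _ _ hpe (@frob_basis_asymp R c m hdc)).
Unshelve. all: by end_near. Qed.
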